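(* Let $F=F(x,y_0,y_1,\ldots,y_n)$ be a polynomial in $n+2$ variables with complex coefficients, and let the power-log series $$\varphi=\sum_{k=0}^{\infty}R_k(\ln x)\,x^{k},\qquad R_k\in\mathbb{C}(t),$$ formally satisfy the algebraic ODE $F(x,y,\delta y,\ldots,\delta^n y)=0$ of order $n$, that is, $$F(x,\Phi):=F(x,\varphi,\delta\varphi,\ldots,\delta^n\varphi)=0 .$$ Suppose that for each $j=0,\ldots,n$ one has $$\frac{\partial F}{\partial y_j}(x,\Phi)=a_j(\ln x)\,x^m+a_j^1(\ln x)\,x^{m+1}+\ldots,\qquad a_j,a_j^1,\ldots\in\mathbb{C}(t),$$ where the integer $m\geqslant 0$ is the same for all $j$, and $a_n\not\equiv 0$. Then for any open sector $S\subset\mathbb{C}$ of sufficiently small radius with vertex at the origin and of opening less than $2\pi$, the series $\varphi$ converges uniformly in $S$.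
   Context: Here $\delta=x\,\frac{d}{dx}$. A power-log series is a formal series $\sum_{k\geqslant0}R_k(\ln x)x^k$ with $R_k\in\mathbb{C}(t)$ rational functions. Such series are added and multiplied formally as power series in $x$ with coefficients in the field $\mathbb{C}(\ln x)$, and $\delta$ acts termwise by $\delta\bigl(R_k(\ln x)x^k\bigr)=x^k\bigl(kR_k+R_k'\bigr)(\ln x)$, where $R_k'=dR_k/dt$. The equality $F(x,\Phi)=0$ is an equality of formal series, where $\Phi=(\varphi,\delta\varphi,\ldots,\delta^n\varphi)$. In the sector $S$, $\ln x$ denotes a holomorphic branch of the logarithm. *)

(* Defs.v *)
From HB Require Import structures.
From mathcomp Require Import all_boot all_order all_algebra.
From mathcomp Require Import complex.
From mathcomp Require Import all_classical all_reals all_analysis.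
From mathcomp Require mpoly.
From mathcomp Require Import ring.

Set Implicit Arguments.
Unset Strict Implicit.
Unset Printing Implicit Defensive.

Import Order.TTheory GRing.Theory Num.Theory.
Import numFieldNormedType.Exports.
Local Open Scope ring_scope.
Local Open Scope classical_set_scope.

Section RationalFunctions.
Variable K : fieldType.
Implicit Types (f : {fraction {poly K}}) (p q : {poly K}).

Definition ratnum f : {poly K} :=
  (repr f : ratio {poly K}).1
    %/ gcdp (repr f : ratio {poly K}).1 (repr f : ratio {poly K}).2.

Definition ratden f : {poly K} :=
  (repr f : ratio {poly K}).2
    %/ gcdp (repr f : ratio {poly K}).1 (repr f : ratio {poly K}).2.

(* [ratnum f] and [ratden f] are coprime (see [coprime_ratnum_ratden]), so the
   roots of [ratden f] are exactly the poles of [f]; at a pole [rateval] takes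
   the junk value 0. *)
Definition ratpole f (z : K) : bool := root (ratden f) z.

Definition rateval f (z : K) : K := (ratnum f).[z] / (ratden f).[z].

Definition ratderiv f : {fraction {poly K}} :=
  tofrac ((ratnum f)^`() * ratden f - ratnum f * (ratden f)^`())
    / tofrac (ratden f ^+ 2).

Lemma repr_den_neq0 f : (repr f : ratio {poly K}).2 != 0.
Proof. exact: denom_ratioP. Qed.

Lemma ratden_neq0 f : ratden f != 0.
Proof.
have h := repr_den_neq0 f.
rewrite /ratden; set d := (repr f : ratio _).2 in h *.
by rewrite dvdp_div_eq0 ?dvdp_gcdr.
Qed.

Lemma fracE (r : ratio {poly K}) :
  \pi_({fraction {poly K}})%qT r = tofrac r.1 / tofrac r.2.
Proof.
have d0 := denom_ratioP r.
apply: (mulIf (x := tofrac r.2)); first by rewrite tofrac_eq0.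
rewrite mulfVK ?tofrac_eq0 //.
rewrite -[_ * _]/(FracField.mul _ _) !piE.
apply/eqmodP; rewrite /= FracField.equivfE /FracField.mulf.
by rewrite !numden_Ratio ?oner_neq0 ?mulr1 ?mulf_neq0 //= mulrC.
Qed.

Lemma ratE f : f = tofrac (ratnum f) / tofrac (ratden f).
Proof.
have d0 := ratden_neq0 f.
rewrite -{1}[f]reprK fracE.
have h := repr_den_neq0 f.
apply/eqP; rewrite eqr_div ?tofrac_eq0 // -!tofracM tofrac_eq /ratnum /ratden.
set u := (repr f : ratio _).1; set v := (repr f : ratio _).2.
have e1 : u %/ gcdp u v * gcdp u v = u by rewrite divpK ?dvdp_gcdl.
have e2 : v %/ gcdp u v * gcdp u v = v by rewrite divpK ?dvdp_gcdr.
rewrite -[X in X * _ == _]e1 -[X in _ == _ * X]e2.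
by rewrite -mulrA [_ * (v %/ _)]mulrC.
Qed.

Lemma coprime_ratnum_ratden f : coprimep (ratnum f) (ratden f).
Proof. by apply: coprimep_div_gcd; rewrite repr_den_neq0 orbT. Qed.

Lemma ratderiv_frac p q : q != 0 ->
  ratderiv (tofrac p / tofrac q)
  = tofrac (p^`() * q - p * q^`()) / tofrac (q ^+ 2).
Proof.
move=> q0; set f := _ / _.
have d0 := ratden_neq0 f.
have := ratE f; rewrite {1}/f => /eqP.
rewrite eqr_div ?tofrac_eq0 // -!tofracM tofrac_eq => /eqP e.
have := congr1 (@deriv _) e; rewrite !derivM => e'.
rewrite /ratderiv.
move: (ratnum f) (ratden f) d0 e e' => a b b0 e e'.
apply/eqP; rewrite eqr_div ?tofrac_eq0 ?expf_neq0 // -!tofracM tofrac_eq.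
rewrite -subr_eq0; apply/eqP.
transitivity ((a^`() * q + a * q^`() - (p^`() * b + p * b^`())) * (b * q)
   + (p * b - a * q) * (b^`() * q + b * q^`())); first by ring.
by rewrite e e' !subrr !mul0r addr0.
Qed.

Lemma rateval_frac p q z : q.[z] != 0 ->
  ~~ ratpole (tofrac p / tofrac q) z /\
  rateval (tofrac p / tofrac q) z = p.[z] / q.[z].
Proof.
move=> qz; have q0 : q != 0 by apply: contraNneq qz => ->; rewrite horner0.
set f := _ / _.
have d0 := ratden_neq0 f.
have := ratE f; rewrite {1}/f => /eqP.
rewrite eqr_div ?tofrac_eq0 // -!tofracM tofrac_eq => /eqP e.
have cop := coprime_ratnum_ratden f.
have dz : (ratden f).[z] != 0.
  have : ratden f %| q.
    have cop' : coprimep (ratden f) (ratnum f) by rewrite coprimep_sym.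
    by rewrite -(Gauss_dvdpr _ cop') -e dvdp_mull.
  by case/dvdpP => c qE; apply: contraNneq qz => dz; rewrite qE hornerM dz mulr0.
split; first by rewrite /ratpole rootE.
apply/eqP; rewrite /rateval eqr_div // -!hornerM; apply/eqP.
by rewrite e.
Qed.

End RationalFunctions.

(* Wrapped in a record so that the product is not the pointwise one that
   functions [nat -> K] already carry. *)
Record fps (K : Type) := Fps { fcoef : nat -> K }.

Section FormalPowerSeries.
Variable K : comNzRingType.
Implicit Types (f g h : fps K) (c : K).

HB.instance Definition _ := gen_eqMixin (fps K).
HB.instance Definition _ := gen_choiceMixin (fps K).

Lemma fpsP f g : fcoef f =1 fcoef g -> f = g.
Proof. by case: f g => [f] [g] /= /funext ->. Qed.

Definition fpsC c : fps K := Fps (fun k => if k == 0%N then c else 0).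
Definition fpsX : fps K := Fps (fun k => (k == 1%N)%:R).
Definition fps_add f g := Fps (fun k => fcoef f k + fcoef g k).
Definition fps_opp f := Fps (fun k => - fcoef f k).
Definition fps_mul f g :=
  Fps (fun k => \sum_(i < k.+1) fcoef f i * fcoef g (k - i)).

Let fps_addA : associative fps_add.
Proof. by move=> f g h; apply: fpsP => k /=; rewrite addrA. Qed.
Let fps_addC : commutative fps_add.
Proof. by move=> f g; apply: fpsP => k /=; rewrite addrC. Qed.
Let fps_add0 : left_id (fpsC 0) fps_add.
Proof. by move=> f; apply: fpsP => k /=; rewrite if_same add0r. Qed.
Let fps_addN : left_inverse (fpsC 0) fps_opp fps_add.
Proof. by move=> f; apply: fpsP => k /=; rewrite if_same addNr. Qed.

HB.instance Definition _ :=
  GRing.isZmodule.Build (fps K) fps_addA fps_addC fps_add0 fps_addN.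

Let trunc N f : {poly K} := \poly_(i < N) fcoef f i.

Let trunc_mul f g N k : (k < N)%N ->
  fcoef (fps_mul f g) k = (trunc N f * trunc N g)`_k.
Proof.
move=> kN; rewrite coefM; apply: eq_bigr => i _; rewrite !coef_poly.
have iN : (i < N)%N by apply: leq_ltn_trans kN; rewrite -ltnS.
by rewrite iN (leq_ltn_trans (leq_subr _ _) kN).
Qed.

Let coef_mul_eq (p p' q q' : {poly K}) k :
  (forall i, (i <= k)%N -> p`_i = p'`_i) ->
  (forall i, (i <= k)%N -> q`_i = q'`_i) -> (p * q)`_k = (p' * q')`_k.
Proof.
move=> ep eq; rewrite !coefM; apply: eq_bigr => i _.
by rewrite ep -1?ltnS // eq ?leq_subr.
Qed.

Let coef_trunc f N k : (k < N)%N -> (trunc N f)`_k = fcoef f k.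
Proof. by move=> kN; rewrite coef_poly kN. Qed.

Let fps_mulA : associative fps_mul.
Proof.
move=> f g h; apply: fpsP => k; rewrite !(trunc_mul _ _ (ltnSn k)).
transitivity ((trunc k.+1 f * (trunc k.+1 g * trunc k.+1 h))`_k).
  apply: coef_mul_eq => // i ik.
  by rewrite coef_trunc ?ltnS // (trunc_mul _ _ (N := k.+1)) ?ltnS.
rewrite mulrA; apply: coef_mul_eq => // i ik.
by rewrite coef_trunc ?ltnS // (trunc_mul _ _ (N := k.+1)) ?ltnS.
Qed.

Let fps_mulC : commutative fps_mul.
Proof.
by move=> f g; apply: fpsP => k; rewrite !(trunc_mul _ _ (ltnSn k)) mulrC.
Qed.

Let fps_mul1 : left_id (fpsC 1) fps_mul.
Proof.
move=> f; apply: fpsP => k /=.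
rewrite big_ord_recl /= mul1r subn0 big1 ?addr0 // => i _.
by rewrite mul0r.
Qed.

Let fps_mulDl : left_distributive fps_mul fps_add.
Proof.
move=> f g h; apply: fpsP => k /=.
by rewrite -big_split; apply: eq_bigr => i _; rewrite mulrDl.
Qed.

Let fps_1neq0 : fpsC 1 != fpsC 0.
Proof.
by apply/eqP => /(congr1 (fun f => fcoef f 0)) /= /eqP; rewrite oner_eq0.
Qed.

HB.instance Definition _ :=
  GRing.Zmodule_isComNzRing.Build (fps K)
    fps_mulA fps_mulC fps_mul1 fps_mulDl fps_1neq0.

End FormalPowerSeries.

(* The coefficient [fcoef phi k] is the rational function R_k of t = ln x. *)
Definition powlog (R : realType) := fps {fraction {poly R[i]}}.
HB.instance Definition _ (R : realType) := GRing.ComNzRing.on (powlog R).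

Section PowerLogSeries.
Variable R : realType.
Local Notation C := R[i].
Local Notation powlog := (powlog R).

Definition pl_delta (phi : powlog) : powlog :=
  Fps (fun k => k%:R * fcoef phi k + ratderiv (fcoef phi k)).

(* Variable 0 of [F] is x, and variable j.+1 is y_j. *)
Definition pl_subst n (F : mpoly.mpoly n.+2 C) (phi : powlog) : powlog :=
  mpoly.mmap (fun c : C => fpsC (tofrac c%:P) : powlog)
    (fun i : 'I_n.+2 => if val i is j.+1 then iter j pl_delta phi
                        else fpsX _ : powlog) F.

Definition dFdy n (j : 'I_n.+1) (F : mpoly.mpoly n.+2 C) : mpoly.mpoly n.+2 C :=
  mpoly.mderiv (lift ord0 j) F.

Definition cexp (z : C) : C :=
  (expR (complex.Re z))%:C%C * (cos (complex.Im z) +i* sin (complex.Im z))%C.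

(* Open sector of radius [r] with vertex 0 bounded by the rays of arguments
   [alpha] and [beta]; its opening is [beta - alpha]. *)
Definition sector (alpha beta r : R) : set C :=
  [set x | exists rho theta : R,
     [/\ 0 < rho < r, alpha < theta < beta
       & x = rho%:C%C * (cos theta +i* sin theta)%C]].

Definition log_branch (S : set C) (L : C -> C) : Prop :=
  forall x, S x -> derivable (L : C^o -> C^o) x 1 /\ cexp (L x) = x.

Definition pl_partial_sum (L : C -> C) (phi : powlog) (N : nat) (x : C) : C :=
  \sum_(k < N) rateval (fcoef phi k) (L x) * x ^+ k.

(* The first clause says that every term R_k(ln x) x^k is defined on [S]. *)
Definition pl_cvg_uniformly (S : set C) (L : C -> C) (phi : powlog) : Prop :=
  (forall k x, S x -> ~~ ratpole (fcoef phi k) (L x)) /\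
  exists f : C -> C,
    {uniform S, (pl_partial_sum L phi : nat -> C -> C^o) @ \oo --> (f : C -> C^o)}.

End PowerLogSeries.

(* Main.v *)
Require Import Defs.
From HB Require Import structures.
From mathcomp Require Import all_boot all_order all_algebra.
From mathcomp Require Import complex.
From mathcomp Require Import all_classical all_reals all_analysis.
From mathcomp Require mpoly.
From mathcomp Require Import ring lra zify.
Import Order.TTheory GRing.Theory Num.Theory.
Import numFieldNormedType.Exports.
Import (canonicals) mpoly.
Local Open Scope ring_scope.

Set Implicit Arguments.
Unset Strict Implicit.
Unset Printing Implicit Defensive.

(* Split [phi] into its terms of degree at most N = m + 1 and x^N psi.  By
   Taylor's formula and the hypothesis on the dF/dy_j, the coefficients of psi
   satisfy [sum_j a_j (N + k + d/dt)^j psi_k = G_(k-1)], where G is a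
   polynomial in x and in the series x^-N delta^j (x^N psi), and the a_j and
   the coefficients of G may be taken in C[t].

   Let q be the radical of a_n.  The indicial equation at a zero of a_n does
   not involve k, and for large k the degree of the left-hand side at infinity
   is governed by [sum_j a_j k^j]; hence psi_k = P_k / q^(lam k) with
   deg P_k = O(k).

   Solving the recursion by integration would lose control of psi_k, but psi_k
   is rational of degree O(k): in the norm |P| = sum_l |p_l| rho^l, the
   derivation d/dt is bounded by O(k / rho) on such functions (Bernstein), and
   division by q costs about rho^(- deg q).  So for a fixed large rho the term
   a_n k^n psi_k dominates, and k^n |psi_k| <= C |G_(k-1)|.  As G_(k-1) only
   involves psi_1, ..., psi_(k-1), the partial sums of the |psi_k| X^k stay
   bounded for small X, which gives |psi_k(t)| <= (A |t|^d)^k for |t| >= rho,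
   for all such t at once.

   In the sector Re (ln x) = ln |x| and Im (ln x) is bounded, so
   A |ln x|^d |x| <= 1/2 near 0 and the series is dominated by a geometric
   one. *)

(** * Rational functions as a differential field *)

(** The constants are found in an order that avoids circularity: the exponent lam of q comes from
    pole and degree arguments alone; rho is chosen in terms of lam; then comes the index beyond
    which the a priori estimate holds; last comes X, in terms of a bound on G that does not depend
    on X. The estimate closes because a_n is nonzero at the common order m: the linear operator has
    true order n, so inverting it gains k^n, which is exactly what the derivatives of order at most
    n inside G cost. Without this balance the majorant argument would leave factorials. N = m + 1 is
    the least N for which the quadratic Taylor remainder, divisible by x^(2N), starts beyond
    x^(N+m); it also leaves the coefficients a_j, which sit at x^m, unaffected by the truncation. A
    bound at one radius suffices because the numerators have degree O(k): passing from |t| = rho to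
    larger |t| costs |t|^O(k), harmless against x^k when t = ln x. *)

(* [{fraction {poly K}}] with [ratderiv], seen through its field axioms only:
   unfolding the quotient type makes [rewrite] and [field] unusable. *)
Record frac_deriv (K F : fieldType) (iota : {rmorphism {poly K} -> F})
    (D : F -> F) : Prop := FracDeriv {
  frac_deriv_inj : injective iota;
  frac_deriv_repr : forall u, exists p q, q != 0 /\ u = iota p / iota q;
  frac_deriv_frac : forall p q, q != 0 ->
     D (iota p / iota q) = iota (p^`() * q - p * q^`()) / iota (q ^+ 2) }.

Section FractionDerivation.
Variables (K F : fieldType) (iota : {rmorphism {poly K} -> F}) (D : F -> F).
Hypothesis DF : frac_deriv iota D.

Lemma iota_eq0 q : (iota q == 0) = (q == 0).
Proof. by rewrite -(inj_eq (frac_deriv_inj DF)) rmorph0. Qed.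

Lemma frac_deriv_embed p : D (iota p) = iota p^`().
Proof.
rewrite -[iota p]divr1 -(rmorph1 iota) (frac_deriv_frac DF) ?oner_eq0 //.
by rewrite derivC mulr0 subr0 mulr1 expr1n rmorph1 divr1.
Qed.

Lemma frac_derivD u v : D (u + v) = D u + D v.
Proof.
have [p [q [q0 ->]]] := frac_deriv_repr DF u.
have [a [b [b0 ->]]] := frac_deriv_repr DF v.
have u0 : iota q != 0 by rewrite iota_eq0.
have v0 : iota b != 0 by rewrite iota_eq0.
have -> : iota p / iota q + iota a / iota b = iota (p * b + a * q) / iota (q * b).
  by rewrite rmorphD !rmorphM; field; rewrite u0 v0.
rewrite !(frac_deriv_frac DF) ?mulf_neq0 // derivD !derivM.
rewrite !(rmorphD, rmorphN, rmorphM, rmorphXn).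
by field; rewrite u0 v0.
Qed.

Lemma frac_derivM u v : D (u * v) = D u * v + u * D v.
Proof.
have [p [q [q0 ->]]] := frac_deriv_repr DF u.
have [a [b [b0 ->]]] := frac_deriv_repr DF v.
have u0 : iota q != 0 by rewrite iota_eq0.
have v0 : iota b != 0 by rewrite iota_eq0.
have -> : iota p / iota q * (iota a / iota b) = iota (p * a) / iota (q * b).
  by rewrite !rmorphM; field; rewrite u0 v0.
rewrite !(frac_deriv_frac DF) ?mulf_neq0 // !derivM.
rewrite !(rmorphD, rmorphN, rmorphM, rmorphXn).
by field; rewrite u0 v0.
Qed.

Lemma frac_deriv0 : D 0 = 0.
Proof. by apply: (@addrI _ (D 0)); rewrite -frac_derivD !addr0. Qed.

(** This is [delta] read on the coefficient of x^k, since delta (u x^k) = x^k (k u + u'). *)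
Definition twder (D : F -> F) (k : nat) (u : F) := k%:R * u + D u.

Lemma iter_twder0 k j : iter j (twder D k) 0 = 0.
Proof. by elim: j => //= j ->; rewrite /twder frac_deriv0 mulr0 addr0. Qed.

End FractionDerivation.

(** * Pole orders and leading coefficients at a point *)

Section LocalExpansion.
Variables (K : numFieldType) (F : fieldType).
Variables (iota : {rmorphism {poly K} -> F}) (D : F -> F).
Hypothesis DF : frac_deriv iota D.
Variables (s : K) (z : {poly K}).
Hypotheses (zs : z.[s] = 0) (dzs : z^`().[s] != 0).
Implicit Types (u v : F) (c : K).

(* [u = c z^-p + ...] near [s], with [z] as a uniformizer. *)
Definition has_lead (p : nat) u c :=
  exists P B : {poly K},
    [/\ B.[s] != 0, u * iota z ^+ p = iota P / iota B & c = P.[s] / B.[s]].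

Lemma iota_local_neq0 (B : {poly K}) : B.[s] != 0 -> iota B != 0.
Proof. by rewrite (iota_eq0 DF); apply: contraNneq => ->; rewrite horner0. Qed.

Lemma has_lead0 p : has_lead p 0 0.
Proof. by exists 0, 1; rewrite hornerC oner_eq0 horner0 !mul0r rmorph0 mul0r. Qed.

Lemma has_leadD p u v c d :
  has_lead p u c -> has_lead p v d -> has_lead p (u + v) (c + d).
Proof.
move=> [P [B [B0 uE ->]]] [P' [B' [B0' vE ->]]].
exists (P * B' + P' * B), (B * B'); rewrite !(hornerD, hornerM) mulf_neq0 //; split => //.
  rewrite mulrDl uE vE rmorphD !rmorphM; field.
  by rewrite !iota_local_neq0.
by field; rewrite B0 B0'.
Qed.

Lemma has_leadM p r u v c d :
  has_lead p u c -> has_lead r v d -> has_lead (p + r) (u * v) (c * d).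
Proof.
move=> [P [B [B0 uE ->]]] [P' [B' [B0' vE ->]]].
exists (P * P'), (B * B'); rewrite !hornerM mulf_neq0 //; split => //.
  rewrite exprD mulrACA uE vE !rmorphM; field.
  by rewrite !iota_local_neq0.
by field; rewrite B0 B0'.
Qed.

Lemma has_lead_iota (P : {poly K}) : has_lead 0 (iota P) P.[s].
Proof. by exists P, 1; rewrite hornerC oner_eq0 expr0 mulr1 rmorph1 !divr1. Qed.

Lemma has_leadZ p u c (P : {poly K}) :
  has_lead p u c -> has_lead p (iota P * u) (P.[s] * c).
Proof. by move=> uc; rewrite -[p]add0n; apply: has_leadM => //; exact: has_lead_iota. Qed.

Lemma has_leadS p u c : has_lead p u c -> has_lead p.+1 u 0.
Proof.
move=> [P [B [B0 uE _]]]; exists (P * z), B; split => //.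
  by rewrite exprSr mulrA uE rmorphM mulrAC.
by rewrite hornerM zs mulr0 mul0r.
Qed.

Lemma has_lead_lt p r u c : (p < r)%N -> has_lead p u c -> has_lead r u 0.
Proof.
move=> pr uc; have -> : r = (r - p.+1 + p.+1)%N by rewrite subnK.
elim: (r - p.+1)%N => [|k IH]; first by rewrite add0n; exact: has_leadS uc.
exact: has_leadS IH.
Qed.

Lemma has_lead_inj p u c d : has_lead p u c -> has_lead p u d -> c = d.
Proof.
move=> [P [B [B0 uE ->]]] [P' [B' [B0' vE ->]]].
move: vE; rewrite uE => /eqP; rewrite eqr_div ?iota_local_neq0 //.
rewrite -!rmorphM (inj_eq (frac_deriv_inj DF)) => /eqP/(congr1 (horner^~ s)).
rewrite !hornerM => e.
by apply/eqP; rewrite eqr_div //; apply/eqP.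
Qed.

Lemma has_lead_le p r u c d :
  c != 0 -> has_lead p u c -> has_lead r u d -> (p <= r)%N.
Proof.
move=> c0 uc ud; rewrite leqNgt; apply: contra_neqN c0 => rp.
exact: has_lead_inj uc (has_lead_lt rp ud).
Qed.

(** As [c] may vanish in [has_lead], [p] there only bounds the order of the pole. Comparing the
    multiplicities of [s] in numerator and denominator makes it exact; a function regular at [s] is
    recorded with [p = 0], whatever its value. *)
Lemma has_lead_ex u : exists p c, has_lead p u c /\ (c != 0 \/ p = 0%N).
Proof.
have [P [B [B0 ->]]] := frac_deriv_repr DF u.
have [P0|P0] := eqVneq P 0.
  by exists 0%N, 0; split; [rewrite P0 rmorph0 mul0r; exact: has_lead0|right].
have [i [P1 /implyP/(_ P0) P1s PE]] := multiplicity_XsubC P s.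
have [j [B1 /implyP/(_ B0) B1s BE]] := multiplicity_XsubC B s.
have [z1 zE] : exists z1, z = z1 * ('X - s%:P) by apply/factor_theorem/rootP.
have z1s : z1.[s] != 0.
  by move: dzs; rewrite zE derivM derivXsubC !hornerE subrr mulr0 add0r.
rewrite rootE in P1s; rewrite rootE in B1s.
have B1F : iota B1 != 0 by exact: iota_local_neq0.
have XF : iota ('X - s%:P) != 0 by rewrite (iota_eq0 DF) polyXsubC_eq0.
have [ji|ij] := leqP j i.
  exists 0%N, ((P1 * ('X - s%:P) ^+ (i - j)).[s] / B1.[s]); split; last by right.
  exists (P1 * ('X - s%:P) ^+ (i - j)), B1; split => //.
  rewrite expr0 mulr1 PE BE -{1}(subnK ji) exprD !rmorphM !rmorphXn.
  by field; rewrite B1F expf_neq0.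
exists (j - i)%N, ((P1 * z1 ^+ (j - i)).[s] / B1.[s]); split.
  exists (P1 * z1 ^+ (j - i)), B1; split => //.
  rewrite PE BE zE -{1}(subnK (ltnW ij)) exprD !rmorphM !rmorphXn exprMn.
  by field; rewrite B1F !expf_neq0.
by left; rewrite hornerM horner_exp mulf_neq0 ?invr_eq0 // mulf_neq0 ?expf_neq0.
Qed.

(** This is the rule (c z^-p)' = -p z' c z^(-p-1) + ...; for p = 0 it correctly yields the
    coefficient 0. *)
Lemma has_lead_deriv p u c :
  has_lead p u c -> has_lead p.+1 (D u) (- (p%:R * z^`().[s]) * c).
Proof.
move=> [P [B [B0 uE ->]]].
have BF := iota_local_neq0 B0.
have B0' : B != 0 by rewrite -(iota_eq0 DF).
exists ((P^`() * B - P * B^`()) * z - (p%:R * z^`() * P * B)), (B ^+ 2).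
rewrite horner_exp expf_neq0 //; split => //; last first.
  rewrite !(hornerD, hornerN, hornerM) zs -polyC_natr hornerC; field; exact: B0.
have := congr1 (fun w => D w * iota z) uE.
rewrite (frac_derivM DF) (frac_deriv_frac DF) //.
rewrite -rmorphXn (frac_deriv_embed DF) rmorphXn deriv_exp.
rewrite mulrDl -mulrA -exprSr => /(canRL (addrK _)) ->.
have -> : u * iota (z^`() * z ^+ p.-1 *+ p) * iota z
        = (p%:R * iota z^`()) * (u * iota z ^+ p).
  case: p {uE} => [|p] /=; first by rewrite !mulr0n rmorph0 mulr0 !mul0r.
  by rewrite exprSr rmorphMn rmorphM rmorphXn -mulr_natr; ring.
rewrite uE !(rmorphD, rmorphN, rmorphM, rmorphXn) rmorph_nat; field; exact: BF.
Qed.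

Lemma has_lead_twder k p u c :
  has_lead p u c -> has_lead p.+1 (twder D k u) (- (p%:R * z^`().[s]) * c).
Proof.
move=> uc; rewrite -[X in has_lead _ _ X]add0r; apply: has_leadD.
  by rewrite -(rmorph_nat iota) -[0](mulr0 (k%:R).[s]); apply/has_leadZ/has_leadS/uc.
exact: has_lead_deriv.
Qed.

(** Its value at p is (-z'(s))^j p (p+1) ... (p+j-1), the factor by which j derivatives multiply the
    leading coefficient of z^-p. It has degree j in p, so different j cannot cancel each other
    identically. *)
Definition indicial_factor j : {poly K} :=
  \prod_(i < j) (- z^`().[s] *: ('X + i%:R%:P)).

Lemma size_indicial_factor j : size (indicial_factor j) = j.+1.
Proof.
rewrite /indicial_factor size_prod => [|i _]; last first.
  by rewrite scaler_eq0 oppr_eq0 (negPf dzs) -size_poly_eq0 size_XaddC.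
under eq_bigr do rewrite size_scale ?oppr_eq0 // size_XaddC.
by rewrite sum_nat_const card_ord muln2 -addnn -addSn addnK.
Qed.

Lemma has_lead_iter_twder k j p u c : has_lead p u c ->
  has_lead (p + j) (iter j (twder D k) u) ((indicial_factor j).[p%:R] * c).
Proof.
move=> uc; elim: j => [|j IH].
  by rewrite addn0 /indicial_factor big_ord0 hornerC mul1r.
rewrite /= addnS; have := has_lead_twder k IH; congr has_lead.
rewrite /indicial_factor big_ord_recr /=
  !(hornerM, hornerZ, hornerD, hornerX, hornerC) natrD; ring.
Qed.
End LocalExpansion.

(** * Poles of rational solutions of linear equations *)

(** The last index with a nonzero coefficient fixes the degree of the sum. This serves twice: for
    the indicial polynomial at a finite pole, in the variable p, and for the leading coefficient at
    infinity, in the variable k. *)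
Lemma triangular_sum_neq0 (K : fieldType) (E : nat -> {poly K}) n (l : 'I_n -> K) :
  (forall j, size (E j) = j.+1) -> (exists j, l j != 0) ->
  \sum_j l j *: E j != 0.
Proof.
move=> sE; elim: n l => [|n IH] l [j lj]; first by case: j {lj}.
rewrite big_ord_recr /=.
have [ln|ln] := eqVneq (l ord_max) 0.
  rewrite ln scale0r addr0; apply: IH.
  have [jn|jn] := ltnP j n.
    by exists (Ordinal jn); rewrite (_ : widen_ord _ _ = j) //; apply: val_inj.
  suff jE : j = ord_max by rewrite jE ln eqxx in lj.
  by apply: val_inj => /=; apply/eqP; rewrite eqn_leq jn -ltnS ltn_ord.
rewrite addrC -size_poly_eq0 size_polyDl size_scale // sE // ltnS.
apply: leq_trans (size_sum _ _ _) _; apply/bigmax_leqP => i _.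
by apply: leq_trans (size_scale_leq _ _) _; rewrite sE.
Qed.

Lemma poly_neq0_natr (K : numFieldType) (P : {poly K}) : P != 0 ->
  exists p0, forall p, (p0 < p)%N -> P.[p%:R] != 0.
Proof.
move=> P0; apply: contrapT => /forallNP H.
have {}H p0 : exists2 p, (p0 < p)%N & P.[p%:R] = 0.
  have /existsNP[p /not_implyP[pp /negP/negPn/eqP]] := H p0; by exists p.
suff [rs [urs srs rrs]] : exists rs : seq nat,
    [/\ uniq rs, size rs = size P & all (fun p => root P p%:R) rs].
  have := @max_poly_roots _ P [seq p%:R | p <- rs] P0.
  rewrite all_map rrs map_inj_uniq; last exact: Num.Theory.mulrIn (oner_neq0 _).
  by rewrite size_map srs ltnn => /(_ isT urs).
elim: (size P) => [|m [rs [urs srs rrs]]]; first by exists [::].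
have [p pp Pp] := H (\max_(i <- rs) i)%N.
exists (p :: rs); rewrite /= urs srs rrs rootE Pp eqxx; split=> //.
rewrite andbT; apply: contraL pp => prs.
by rewrite -leqNgt; apply: leq_bigmax_seq.
Qed.

Section LocalSolution.
Variables (K : numFieldType) (F : fieldType).
Variables (iota : {rmorphism {poly K} -> F}) (D : F -> F).
Hypothesis DF : frac_deriv iota D.
Variables (n : nat) (a : 'I_n.+1 -> {poly K}).

Definition diffop (k : nat) (u : F) : F :=
  \sum_j iota (a j) * iter j (twder D k) u.

Section Place.
Variables (s : K) (z : {poly K}).
Hypotheses (zs : z.[s] = 0) (dzs : z^`().[s] != 0).
Local Notation has_lead := (has_lead iota s z).

Lemma has_lead_sum p (u : 'I_n.+1 -> F) (c : 'I_n.+1 -> K) :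
  (forall j, has_lead p (u j) (c j)) -> has_lead p (\sum_j u j) (\sum_j c j).
Proof.
move=> uc; apply: (big_ind2 (fun u c => has_lead p u c)) => //.
  exact: has_lead0.
by move=> *; exact: (has_leadD DF).
Qed.

(* The indicial polynomial at [s] does not depend on [k], since multiplying by
   [k] does not raise the order of a pole. *)
Definition pole_data (e H : nat) (l : 'I_n.+1 -> K) (p0 : nat) :=
  [/\ (n <= H)%N,
      forall j : 'I_n.+1, has_lead (H - j) (iota (a j) / iota z ^+ e) (l j)
    & forall p, (p0 < p)%N ->
        (\sum_j l j *: indicial_factor s z j).[p%:R] != 0].

(** If the exact order p of [u] exceeded both [p0] and [M], every term of the operator would land at
    order p + H at most, with total leading coefficient nonzero by the choice of [p0]. The image
    would then have order p + H >= p > M, a contradiction. *)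
Lemma pole_data_bound e H l p0 k u M d : pole_data e H l p0 ->
  has_lead M (diffop k u / iota z ^+ e) d ->
  exists c, has_lead (maxn p0 M) u c.
Proof.
move=> [nH al ind] gM.
have [p [c [uc c0]]] := has_lead_ex DF zs dzs u.
have [pm|pm] := leqP p (maxn p0 M).
  move: pm; rewrite leq_eqVlt => /orP[/eqP <-|pm]; first by exists c.
  by exists 0; exact: has_lead_lt uc.
have pp0 : (p0 < p)%N by apply: leq_ltn_trans pm; exact: leq_maxl.
have pM : (M < p)%N by apply: leq_ltn_trans pm; exact: leq_maxr.
case: c0 => [c0|p0E]; last by rewrite p0E in pM.
suff : has_lead (p + H) (diffop k u / iota z ^+ e)
    ((\sum_j l j *: indicial_factor s z j).[p%:R] * c).
  move=> /(has_lead_le DF zs)/(_ gM); rewrite mulf_neq0 ?ind // => /(_ isT).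
  by move=> pHM; have := leq_trans pM (leq_trans (leq_addr H p) pHM); rewrite ltnn.
rewrite /diffop mulr_suml horner_sum mulr_suml; apply: has_lead_sum => j.
have jH : (j <= H)%N by apply: leq_trans nH; rewrite -ltnS.
have -> : (p + H = H - j + (p + j))%N by lia.
rewrite mulrAC hornerZ -[_ * _ * c]mulrA; apply: (has_leadM DF) => //.
exact: (has_lead_iter_twder DF zs).
Qed.

Lemma pole_data_ex : a ord_max != 0 ->
  exists e H l p0, pole_data e H l p0.
Proof.
(* The multiplicity of [s] in [a ord_max] is below its size, so after division by [z ^+ e] a genuine
   pole remains. Hence H > n, and the maximum defining [H] cannot be reached at a [j] with
   [p j = 0], where [c j] might vanish. *)
move=> an0; set e := size (a ord_max).
have ex j := has_lead_ex DF zs dzs (iota (a j) / iota z ^+ e).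
have [p {}ex] := choice ex; have [c pc] := choice ex.
have pn : (0 < p ord_max)%N.
  rewrite lt0n; apply/negP => /eqP pn0; have [+ _] := pc ord_max.
  rewrite pn0 => -[P [B [Bs + _]]]; rewrite expr0 mulr1 -rmorphXn => /eqP.
  have zF : iota z != 0.
    by rewrite (iota_eq0 DF); apply: contraNneq dzs => ->; rewrite deriv0 horner0.
  rewrite eqr_div ?rmorphXn ?expf_neq0 ?(iota_local_neq0 DF Bs) //.
  rewrite -rmorphXn -!rmorphM (inj_eq (frac_deriv_inj DF)) => /eqP anE.
  have : ('X - s%:P) ^+ e %| a ord_max * B.
    rewrite anE dvdp_mull // dvdp_exp2r //.
    by rewrite dvdp_XsubCl rootE zs.
  rewrite Gauss_dvdpl; last first.
    by apply/coprimep_expl; rewrite coprimep_sym coprimep_XsubC rootE.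
  move=> /(dvdp_leq an0); rewrite size_exp_XsubC ltnn //.
pose H := \max_(j < n.+1) (p j + j)%N.
have pH (j : 'I_n.+1) : (p j + j <= H)%N by exact: leq_bigmax.
pose l (j : 'I_n.+1) := if (p j + j == H)%N then c j else 0.
have nH : (n <= H)%N by have := pH ord_max; rewrite /=; lia.
have [j0 j0H] : exists j0 : 'I_n.+1, l j0 != 0.
  have [j0 /esym j0H] := @bigop.eq_bigmax 'I_n.+1 (fun j => (p j + j)%N) (eq_ind_r (leq 1) (ltn0Sn n) (card_ord n.+1)).
  exists j0; rewrite /l -/H in j0H *; rewrite j0H eqxx.
  have [_ []] // := pc j0 => pj0; have := pH ord_max; have := ltn_ord j0.
  by move: j0H; rewrite pj0 /=; lia.
have L0 : \sum_j l j *: indicial_factor s z j != 0.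
  by apply: triangular_sum_neq0; [exact: size_indicial_factor|exists j0].
have [p0 p0P] := poly_neq0_natr L0.
exists e, H, l, p0; split=> // j; rewrite /l; have [pcj _] := pc j.
case: ifPn => [/eqP <-|neq]; first by rewrite addnK.
by apply: (has_lead_lt zs _ pcj); rewrite ltn_subRL addnC ltn_neqAle neq pH.
Qed.

End Place.

(** Away from the zeros of a_n only the term j = n reaches order p + n, and the indicial polynomial
    is a multiple of p (p+1) ... (p+n-1), nonzero for every p > 0. So a solution acquires no pole
    that the right-hand side lacks. *)
Lemma pole_data_regular s : (a ord_max).[s] != 0 ->
  exists l, pole_data s ('X - s%:P) 0 n l 0.
Proof.
move=> ans.
have Xs : ('X - s%:P).[s] = 0 by rewrite hornerXsubC subrr.
have dXs : ('X - s%:P)^`().[s] != 0 by rewrite derivXsubC hornerC oner_eq0.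
exists (fun j => if j == ord_max then (a ord_max).[s] else 0); split=> //.
  move=> j; rewrite expr0 divr1; case: eqP => [->|/eqP jn].
    by rewrite subnn; exact: has_lead_iota.
  apply: (has_lead_lt Xs _ (has_lead_iota iota s _ _)).
  rewrite subn_gt0 ltn_neqAle -ltnS ltn_ord andbT.
  by apply: contra jn => /eqP jn; apply/eqP/val_inj.
move=> p p0; rewrite (bigD1 ord_max) //= eqxx big1 ?addr0 => [|j /negPf ->].
  rewrite hornerZ mulf_neq0 // horner_prod prodf_seq_neq0.
  apply/allP => i _; rewrite derivXsubC !(hornerZ, hornerD, hornerX, hornerC).
  by rewrite mulN1r oppr_eq0 -natrD pnatr_eq0 addn_eq0 negb_and -lt0n p0.
by rewrite scale0r.
Qed.

End LocalSolution.

Section GlobalSolution.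
Variables (K : numClosedFieldType) (F : fieldType).
Variables (iota : {rmorphism {poly K} -> F}) (D : F -> F).
Hypothesis DF : frac_deriv iota D.

Lemma frac_regular u :
  (forall s, exists P B, B.[s] != 0 /\ u = iota P / iota B) -> exists P, u = iota P.
Proof.
move=> reg; have [p [q [q0 uE]]] := frac_deriv_repr DF u.
set d := gcdp p q; have d0 : d != 0 by rewrite gcdp_eq0 negb_and q0 orbT.
have [q1 qE] : exists q1, q = q1 * d by apply/dvdpP; exact: dvdp_gcdr.
have [p1 pE] : exists p1, p = p1 * d by apply/dvdpP; exact: dvdp_gcdl.
have q10 : q1 != 0 by apply: contraNneq q0 => q1E; rewrite qE q1E mul0r.
have cop : coprimep p1 q1.
  have := coprimep_div_gcd (p := p) (q := q); rewrite q0 orbT => /(_ isT).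
  by rewrite -/d pE qE !mulpK.
have iF Q : Q != 0 -> iota Q != 0 by rewrite (iota_eq0 DF).
have {}uE : u = iota p1 / iota q1.
  by rewrite uE pE qE !rmorphM; field; rewrite !iF.
have [sq1|sq1] := eqVneq (size q1) 1%N.
  move/eqP: sq1; rewrite size_poly_eq1 => /eqpf_eq [c c0 q1E].
  exists (c^-1 *: p1); rewrite uE q1E -!mul_polyC mulr1.
  have cF : iota c%:P != 0 by rewrite iF // polyC_eq0.
  by apply: (mulIf cF); rewrite mulfVK // -rmorphM mulrAC -polyCM mulVf // mul1r.
have [s sq] := elimT (closed_rootP q1) sq1.
have [P [B [Bs uE']]] := reg s.
have B0 : B != 0 by apply: contraNneq Bs => ->; rewrite horner0.
move/eqP: uE'; rewrite uE eqr_div ?iF // -!rmorphM (inj_eq (frac_deriv_inj DF)).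
move=> /eqP/(congr1 (horner^~ s)); rewrite !hornerM.
rewrite (rootP sq) mulr0 => /eqP; rewrite mulf_eq0 (negPf Bs) orbF => p1s.
by have := coprimep_root cop p1s; rewrite (rootP sq) eqxx.
Qed.

Variables (n : nat) (a : 'I_n.+1 -> {poly K}) (q : {poly K}).
Hypotheses (an0 : a ord_max != 0) (q0 : q != 0)
  (root_aq : forall s, root (a ord_max) s -> root q s)
  (sqfree_q : forall s, root q s -> q^`().[s] != 0).

(** One [e] serves every [k] because [pole_data] does not mention [k]; it is a maximum over the
    finitely many roots of [q]. These roots being simple, [q] itself is the uniformizer at each of
    them, so that local pole orders are directly exponents of [q]. *)
Lemma diffop_solution_poles : exists e, forall k u M Q,
  diffop iota D a k u * iota q ^+ M = iota Q ->
  exists P, u * iota q ^+ (M + e) = iota P.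
Proof.
have [rs qE] := closed_field_poly_normal q.
have rsP s : root q s = (s \in rs).
  by rewrite qE rootZ ?lead_coef_eq0 // root_prod_XsubC.
have iq0 : iota q != 0 by rewrite (iota_eq0 DF).
have [B BP] : exists B, forall s, s \in rs -> exists e H l p0,
    pole_data iota a s q e H l p0 /\ (p0 + e <= B)%N.
  have {rsP}rsP : forall s, s \in rs -> root q s by move=> s; rewrite rsP.
  elim: rs rsP {qE} => [|s rs IH] rsP; first by exists 0%N.
  have [B BP] := IH (fun s' s'rs => rsP s' (@mem_behead _ (s :: rs) s' s'rs)).
  have qs : root q s by apply: rsP; rewrite inE eqxx.
  have [e [H [l [p0 dat]]]] := pole_data_ex DF (rootP qs) (sqfree_q qs) an0.
  exists (maxn (p0 + e) B) => s'; rewrite inE => /orP[/eqP ->|/BP].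
    by exists e, H, l, p0; split; rewrite // leq_maxl.
  move=> [e' [H' [l' [p0' [dat' le]]]]]; exists e', H', l', p0'; split=> //.
  by apply: leq_trans le _; exact: leq_maxr.
exists B => k u M Q gQ; apply: frac_regular => s.
have [qs|qs] := boolP (root q s); last first.
  have [l dat] := pole_data_regular iota (contra (@root_aq s) qs : (a ord_max).[s] != 0).
  have qMs m : (q ^+ m).[s] != 0 by rewrite horner_exp expf_neq0.
  have Xs : ('X - s%:P).[s] = 0 by rewrite hornerXsubC subrr.
  have dXs : ('X - s%:P)^`().[s] != 0 by rewrite derivXsubC hornerC oner_eq0.
  have g0 : has_lead iota s ('X - s%:P) 0 (diffop iota D a k u / iota ('X - s%:P) ^+ 0)
      (Q.[s] / (q ^+ M).[s]).
    exists Q, (q ^+ M); split=> //; rewrite !expr0 divr1 mulr1.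
    by rewrite -gQ rmorphXn mulfK ?expf_neq0.
  have [c [P [R [Rs uE _]]]] := pole_data_bound DF Xs dXs dat g0.
  exists (P * q ^+ (M + B)), R; split=> //.
  by move: uE; rewrite maxnn expr0 mulr1 => ->; rewrite rmorphM rmorphXn mulrAC.
have /BP[e [H [l [p0 [dat le]]]]] : s \in rs by rewrite -rsP.
have gM : has_lead iota s q (M + e) (diffop iota D a k u / iota q ^+ e) Q.[s].
  exists Q, 1; rewrite hornerC oner_eq0 rmorph1 !divr1; split=> //.
  by rewrite -gQ exprD [_ ^+ M * _]mulrC mulrA mulfVK ?expf_neq0.
have [c uc] := pole_data_bound DF (rootP qs) (sqfree_q qs) dat gM.
have [P [R [Rs uE _]]] := uc.
exists (P * q ^+ (M + B - maxn p0 (M + e))), R; split=> //.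
rewrite rmorphM rmorphXn mulrAC -uE -mulrA -exprD subnKC //.
by rewrite geq_max; lia.
Qed.
End GlobalSolution.

(** * Numerators and degree at infinity *)

(* Different canonical paths to the semiring structure of [K] make [lia] see
   several copies of the same polynomial size; [polysize] identifies them. *)
Definition polysize (K : numFieldType) (p : {poly K}) : nat := size p.

Ltac fold_size :=
  repeat match goal with
  | |- context C [@size _ (@polyseq _ ?p)] =>
      let G := context C [polysize p] in change G
  | H : context C [@size _ (@polyseq _ ?p)] |- _ =>
      let G := context C [polysize p] in change G in H
  end.
Ltac size_lia := fold_size; lia.
Ltac size_nia := fold_size; nia.

Section Numerators.
Variables (K : numFieldType) (F : fieldType).
Variables (iota : {rmorphism {poly K} -> F}) (D : F -> F).
Hypothesis DF : frac_deriv iota D.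
Variable q : {poly K}.
Hypothesis q0 : q != 0.
Local Notation e := (size q).-1.

(** Numerator, over q^(M+j), of the j-th iterate of [twder] on P / q^M, obtained from (P / q^M)' =
    (q P' - M q' P) / q^(M+1) without reducing the fraction. *)
Fixpoint twder_num (M k : nat) (P : {poly K}) (j : nat) : {poly K} :=
  if j is j'.+1 then
    let P' := twder_num M k P j' in
    k%:R *: (q * P') + (q * P'^`() - (M + j')%:R *: (q^`() * P'))
  else P.

Lemma twder_numP M k P j u : u * iota q ^+ M = iota P ->
  iter j (twder D k) u * iota q ^+ (M + j) = iota (twder_num M k P j).
Proof.
move=> uP; elim: j => [|j IH]; first by rewrite addn0.
rewrite addnS [iter _ _ _]/= [twder_num _ _ _ _]/=.
move: (iter j _ u) (twder_num _ _ _ j) (M + j)%N IH => v V m IH.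
have := congr1 (fun w => D w * iota q) IH.
rewrite (frac_derivM DF) (frac_deriv_embed DF) -rmorphXn (frac_deriv_embed DF).
rewrite rmorphXn deriv_exp mulrDl -mulrA -exprSr => /(canRL (addrK _)) DvE.
rewrite /twder mulrDl DvE -!mul_polyC !polyC_natr.
have -> : v * iota (q^`() * q ^+ m.-1 *+ m) * iota q
        = m%:R * iota q^`() * (v * iota q ^+ m).
  case: m {IH DvE} => [|m] /=; first by rewrite !mulr0n rmorph0 mulr0 !mul0r.
  by rewrite exprSr rmorphMn rmorphM rmorphXn -mulr_natr; ring.
rewrite exprSr IH !(rmorphD, rmorphN, rmorphM) !rmorph_nat.
have -> : k%:R * v * (iota q ^+ m * iota q) = k%:R * (v * iota q ^+ m) * iota q by ring.
rewrite IH; ring.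
Qed.

Lemma size_mulq (P : {poly K}) : (size (q * P)%R <= size P + e)%N.
Proof.
by apply: leq_trans (size_polyMleq _ _) _; move: q0; rewrite -size_poly_gt0; size_lia.
Qed.

Lemma size_deriv_leq (P : {poly K}) : (size P^`() <= (size P).-1)%N.
Proof. by rewrite -[in X in (_ <= X)%N]subn1 /deriv; apply: leq_trans (size_poly _ _) _; size_lia. Qed.

(** Differentiation lowers the degree at infinity by one. Compared with k q P this is a lower-order
    term, so that at infinity the iterates of [twder] behave as multiplication by k^j. *)
Lemma size_num_lower m (P : {poly K}) :
  (size (q * P^`() - m%:R *: (q^`() * P))%R <= (size P + e).-1)%N.
Proof.
have [->|P0] := eqVneq P 0.
  by rewrite deriv0 !mulr0 scaler0 subr0 size_poly0.
apply: leq_trans (size_polyD _ _) _; rewrite geq_max size_polyN; apply/andP; split.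
  apply: leq_trans (size_mulq _) _; have := size_deriv_leq P.
  by move: P0; rewrite -size_poly_gt0; size_lia.
apply: leq_trans (size_scale_leq _ _) _; apply: leq_trans (size_polyMleq _ _) _.
by have := size_deriv_leq q; size_lia.
Qed.

Lemma size_twder_num M k P j : (size (twder_num M k P j) <= size P + e * j)%N.
Proof.
elim: j => [|j IH] /=; first by rewrite muln0 addn0.
move: (twder_num _ _ _ j) IH => V IH.
apply: leq_trans (size_polyD _ _) _; rewrite geq_max; apply/andP; split.
  apply: leq_trans (size_scale_leq _ _) _; apply: leq_trans (size_mulq _) _.
  by rewrite mulnS; size_lia.
by apply: leq_trans (size_num_lower _ _) _; rewrite mulnS; size_lia.
Qed.

Lemma size_twder_num_lower M k P j :
  (size (twder_num M k P j - k%:R ^+ j *: (q ^+ j * P))%R <= (size P + e * j).-1)%N.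
Proof.
elim: j => [|j IH] /=; first by rewrite !expr0 mul1r scale1r subrr size_poly0.
set V := twder_num _ _ _ j in IH *; have sV := size_twder_num M k P j; rewrite -/V in sV.
have -> : k%:R *: (q * V) + (q * V^`() - (M + j)%:R *: (q^`() * V))
    - k%:R ^+ j.+1 *: (q ^+ j.+1 * P)
  = k%:R *: (q * (V - k%:R ^+ j *: (q ^+ j * P)))
    + (q * V^`() - (M + j)%:R *: (q^`() * V)).
  rewrite -!mul_polyC !exprS polyCM; ring.
apply: leq_trans (size_polyD _ _) _; rewrite geq_max; apply/andP; split.
  apply: leq_trans (size_scale_leq _ _) _.
  have [P0|P0] := eqVneq (V - k%:R ^+ j *: (q ^+ j * P)) 0.
    by rewrite P0 mulr0 size_poly0.
  move: IH P0; rewrite -size_poly_gt0 => IH P0.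
  apply: leq_trans (size_mulq _) _; move: IH P0; rewrite mulnS; size_lia.
apply: leq_trans (size_num_lower _ _) _; rewrite mulnS; size_lia.
Qed.

Variables (n : nat) (a : 'I_n.+1 -> {poly K}).

Definition diffop_num M k P :=
  \sum_(j < n.+1) a j * q ^+ (n - j) * twder_num M k P j.

Lemma diffop_numP M k P u : u * iota q ^+ M = iota P ->
  diffop iota D a k u * iota q ^+ (M + n) = iota (diffop_num M k P).
Proof.
move=> uP; rewrite /diffop mulr_suml rmorph_sum; apply: eq_bigr => j _ /=.
rewrite !rmorphM -(twder_numP k j uP) rmorphXn.
have {1}-> : (M + n = (n - j) + (M + j))%N by have := ltn_ord j; size_lia.
by rewrite exprD; ring.
Qed.

(** Up to terms of lower degree the numerator is (sum_j k^j a_j) q^n P. If d is the largest size of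
    the a_j, the coefficient of t^(d-1) in the bracket is a nonzero polynomial in k, so from some k
    on the top degree does not cancel. *)
Lemma diffop_num_degree : a ord_max != 0 -> exists k0, forall k M (P : {poly K}),
  (k0 < k)%N -> P != 0 -> (size P + e * n <= size (diffop_num M k P))%N.
Proof.
move=> an0; pose d := \max_(j < n.+1) size (a j).
have [j0 dE] := @bigop.eq_bigmax 'I_n.+1 (fun j => size (a j))
  (eq_ind_r (leq 1) (ltn0Sn n) (card_ord n.+1)).
rewrite -/d in dE.
have ad j : (size (a j) <= d)%N by exact: leq_bigmax.
have d0 : (0 < d)%N by apply: leq_trans (ad ord_max); rewrite size_poly_gt0.
have L0 : \sum_(j < n.+1) (a j)`_d.-1 *: 'X^j != 0 :> {poly K}.
  apply: triangular_sum_neq0 => [j|]; first exact: size_polyXn.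
  exists j0; rewrite dE -lead_coefE lead_coef_eq0 -size_poly_gt0 -dE //.
have [k0 k0P] := poly_neq0_natr L0.
exists k0 => k M P k0k P0.
pose A := \sum_(j < n.+1) k%:R ^+ j *: a j.
have sA : size A = d.
  apply/eqP; rewrite eqn_leq; apply/andP; split.
    apply: leq_trans (size_sum _ _ _) _; apply/bigmax_leqP => j _.
    by apply: leq_trans (size_scale_leq _ _) _.
  rewrite leqNgt; apply/negP => Ad.
  have Ad0 : A`_d.-1 = 0 by apply: nth_default; size_lia.
  have /eqP := k0P k k0k; apply; rewrite horner_sum -[RHS]Ad0 /A coef_sum.
  apply: eq_bigr => j _.
  by rewrite coefZ hornerZ hornerXn mulrC.
have A0 : A != 0 by rewrite -size_poly_gt0 sA.
have qn0 m : q ^+ m != 0 by rewrite expf_neq0.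
have sq m : size (q ^+ m) = (e * m).+1 by rewrite -[LHS]prednK ?size_poly_gt0 ?size_exp.
have -> : diffop_num M k P = A * (q ^+ n * P)
    + \sum_(j < n.+1) a j * q ^+ (n - j) * (twder_num M k P j - k%:R ^+ j *: (q ^+ j * P)).
  rewrite /diffop_num /A mulr_suml -big_split /=; apply: eq_bigr => j _.
  rewrite -[in q ^+ n](subnK (_ : j <= n)%N) -1?ltnS // exprD -!mul_polyC; ring.
have P1 : (0 < size P)%N by rewrite size_poly_gt0.
have sM : size (A * (q ^+ n * P)) = (d + e * n + size P).-1.
  by rewrite !size_mul ?mulf_neq0 // sA sq; size_lia.
rewrite size_polyDl sM; first by size_lia.
rewrite (leq_ltn_trans (size_sum _ _ _)) //.
have -> : (d + e * n + size P).-1 = (d + e * n + size P).-2.+1 by size_lia.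
rewrite ltnS; apply/bigmax_leqP => j _.
have jn : (j <= n)%N by rewrite -ltnS.
have := size_twder_num_lower M k P j.
move: (_ - _ *: _) => V sV.
have [V0|V0] := eqVneq V 0; first by rewrite V0 mulr0 size_poly0.
have {}V0 : (0 < size V)%N by rewrite size_poly_gt0.
apply: leq_trans (size_polyMleq _ _) _.
have := size_polyMleq (a j) (q ^+ (n - j)); rewrite sq => saq.
have en : (e * n = e * (n - j) + e * j)%N by rewrite -mulnDr subnK.
have := ad j.
move: (e * n)%N (e * (n - j))%N (e * j)%N en saq sV => x y w en saq sV; size_lia.
Qed.

(** Since [size q] is one more than the degree of [q], the bound allows denominator q^M together
    with growth up to t^M at infinity. Thus levels add under multiplication, and every polynomial P
    lies in level [size P]. *)
Definition in_level M u :=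
  exists2 P, u * iota q ^+ M = iota P & (size P <= size q * M + 1)%N.

End Numerators.

Section Levels.
Variables (K : numClosedFieldType) (F : fieldType).
Variables (iota : {rmorphism {poly K} -> F}) (D : F -> F).
Hypothesis DF : frac_deriv iota D.
Variables (n : nat) (a : 'I_n.+1 -> {poly K}) (q : {poly K}).
Hypotheses (an0 : a ord_max != 0) (q0 : q != 0)
  (root_aq : forall s, root (a ord_max) s -> root q s)
  (sqfree_q : forall s, root q s -> q^`().[s] != 0).

(** For k up to [k0] the leading coefficients at infinity may cancel, and then only the existence of
    some level is claimed; the uniform gain [e] is available beyond [k0]. *)
Lemma diffop_solution_level : exists e k0, forall k u M,
  in_level iota q M (diffop iota D a k u) ->
  (exists M', in_level iota q M' u) /\
  ((k0 < k)%N -> in_level iota q (M + e) u).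
Proof.
have [e eP] := diffop_solution_poles DF an0 q0 root_aq sqfree_q.
have [k0 k0P] := diffop_num_degree q0 an0.
have sq0 : (0 < size q)%N by rewrite size_poly_gt0.
have sq m : size (q ^+ m) = ((size q).-1 * m).+1.
  by rewrite -[LHS]prednK ?size_poly_gt0 ?size_exp ?expf_neq0.
have sqM (P : {poly K}) m : (size (P * q ^+ m)%R <= size P + (size q).-1 * m)%N.
  by apply: leq_trans (size_polyMleq _ _) _; rewrite sq addnS.
exists e, k0 => k u M [Q gQ sQ]; have [P uP] := eP _ _ _ _ gQ; split.
  exists (M + e + size P)%N, (P * q ^+ size P).
    by rewrite exprD mulrA uP rmorphM rmorphXn.
  apply: leq_trans (sqM _ _) _; rewrite -[size P in X in (X <= _)%N]muln1.
  size_nia.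
move=> k0k; exists P => //.
have [->|P0] := eqVneq P 0; first by rewrite size_poly0.
have := k0P k (M + e)%N P k0k P0.
have -> : diffop_num q a (M + e) k P = Q * q ^+ (e + n).
  apply: (frac_deriv_inj DF); rewrite -(diffop_numP DF q0 a k uP) rmorphM rmorphXn.
  by rewrite -gQ -mulrA -exprD addnA.
have := sqM Q (e + n)%N; have /= sqE := prednK sq0.
have -> : (size q * (M + e) + 1 = M + e + ((size q).-1 * M + (size q).-1 * e) + 1)%N.
  by rewrite -[in LHS]sqE mulSn mulnDr.
have {}sQ : (size Q <= M + (size q).-1 * M + 1)%N by rewrite -mulSn sqE.
rewrite mulnDr => h1 h2; have {h1 h2} := leq_trans h2 h1; fold_size.
by move: (_.-1 * M)%N (_.-1 * e)%N (_.-1 * n)%N sQ => x y w; lia.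
Qed.

End Levels.

(** * A norm on polynomials *)

Record abs_value (K : numFieldType) (R : realFieldType) (nc : K -> R) : Prop :=
  AbsValue {
    absv_ge0 : forall z, 0 <= nc z;
    absv_eq0 : forall z, nc z = 0 -> z = 0;
    absvM : forall z w, nc (z * w) = nc z * nc w;
    absvD : forall z w, nc (z + w) <= nc z + nc w;
    absvN : forall z, nc (- z) = nc z;
    absv_nat : forall k : nat, nc k%:R = k%:R }.

Section CoefficientNorm.
Variables (K : numFieldType) (R : realFieldType) (nc : K -> R).
Hypothesis Nc : abs_value nc.
Implicit Types (P Q a : {poly K}) (rho : R).

Lemma absv0 : nc 0 = 0. Proof. exact: (absv_nat Nc 0). Qed.
Lemma absv1 : nc 1 = 1. Proof. exact: (absv_nat Nc 1). Qed.
Lemma absvX z m : nc (z ^+ m) = nc z ^+ m.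
Proof. by elim: m => [|m IH]; rewrite ?expr0 ?absv1 // !exprS (absvM Nc) IH. Qed.
Lemma absv_gt0 z : z != 0 -> 0 < nc z.
Proof.
move=> z0; rewrite lt_def (absv_ge0 Nc) andbT.
by apply: contra z0 => /eqP/(absv_eq0 Nc)/eqP.
Qed.
Lemma absv_sum m (f : 'I_m -> K) : nc (\sum_i f i) <= \sum_i nc (f i).
Proof.
elim/big_ind2 : _ => //; first by rewrite absv0.
by move=> x1 y1 x2 y2 h1 h2; apply: le_trans (absvD Nc _ _) _; exact: lerD.
Qed.

Definition nrm rho P : R := \sum_(i < size P) nc P`_i * rho ^+ i.

Lemma nrm_widen rho P N : (size P <= N)%N ->
  nrm rho P = \sum_(i < N) nc P`_i * rho ^+ i.
Proof.
move=> PN; rewrite [LHS]/nrm (big_ord_widen N (fun i => nc P`_i * rho ^+ i)) //.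
rewrite big_mkcond; apply: eq_bigr => i _; case: ltnP => // Pi.
by rewrite nth_default // absv0 mul0r.
Qed.

Section Radius.
Variable rho : R.
Hypothesis rho1 : 1 <= rho.

Let rho0 : 0 < rho. Proof. exact: lt_le_trans rho1. Qed.
Let rhoX m : 0 <= rho ^+ m. Proof. by rewrite exprn_ge0 // ltW. Qed.

Lemma nrm_ge0 P : 0 <= nrm rho P.
Proof. by apply: sumr_ge0 => i _; rewrite mulr_ge0 // (absv_ge0 Nc). Qed.

Lemma nrm0 : nrm rho 0 = 0.
Proof. by rewrite /nrm size_poly0 big_ord0. Qed.

Lemma nrmD P Q : nrm rho (P + Q) <= nrm rho P + nrm rho Q.
Proof.
pose N := maxn (size P) (size Q).
rewrite (@nrm_widen _ (P + Q) N) ?size_polyD //.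
rewrite (@nrm_widen _ P N) ?leq_maxl // (@nrm_widen _ Q N) ?leq_maxr //.
rewrite -big_split; apply: ler_sum => i _ /=.
by rewrite coefD -mulrDl ler_wpM2r // (absvD Nc).
Qed.

Lemma nrmN P : nrm rho (- P) = nrm rho P.
Proof. by rewrite /nrm size_polyN; apply: eq_bigr => i _; rewrite coefN (absvN Nc). Qed.

Lemma nrmB P Q : nrm rho (P - Q) <= nrm rho P + nrm rho Q.
Proof. by rewrite -(nrmN Q); exact: nrmD. Qed.

Lemma nrmZ c P : nrm rho (c *: P) = nc c * nrm rho P.
Proof.
rewrite (@nrm_widen _ (c *: P) (size P)) ?size_scale_leq // mulr_sumr.
by apply: eq_bigr => i _; rewrite coefZ (absvM Nc) mulrA.
Qed.

Lemma nrm_sum (I : Type) (r : seq I) (f : I -> {poly K}) :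
  nrm rho (\sum_(i <- r) f i) <= \sum_(i <- r) nrm rho (f i).
Proof.
elim/big_ind2 : _ => //; first by rewrite nrm0.
by move=> x1 y1 x2 y2 h1 h2; apply: le_trans (nrmD _ _) _; exact: lerD.
Qed.

Lemma nrmXnM m P : nrm rho ('X^m * P) = rho ^+ m * nrm rho P.
Proof.
rewrite (@nrm_widen _ _ (m + size P)).
  rewrite big_split_ord /= big1 ?add0r => [|i _].
    rewrite mulr_sumr; apply: eq_bigr => i _.
    by rewrite coefXnM ltnNge leq_addr /= addKn exprD; ring.
  by rewrite coefXnM ltn_ord absv0 mul0r.
by apply: leq_trans (size_polyMleq _ _) _; rewrite size_polyXn addSn.
Qed.

Lemma nrmM P Q : nrm rho (P * Q) <= nrm rho P * nrm rho Q.
Proof.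
rewrite -[P in X in X <= _]coefK poly_def mulr_suml.
apply: le_trans (nrm_sum _ _) _; rewrite [in leRHS]/nrm mulr_suml.
apply: ler_sum => i _.
by rewrite -scalerAl nrmZ nrmXnM mulrA.
Qed.

Lemma nrm1 : nrm rho 1 = 1.
Proof. by rewrite /nrm size_poly1 big_ord1 coefC eqxx absv1 mul1r expr0. Qed.

Lemma nrm_exp P m : nrm rho (P ^+ m) <= nrm rho P ^+ m.
Proof.
elim: m => [|m IH]; first by rewrite !expr0 nrm1.
rewrite !exprS; apply: le_trans (nrmM _ _) _.
by rewrite ler_wpM2l // nrm_ge0.
Qed.

Lemma nrm_deriv P : rho * nrm rho P^`() <= (size P).-1%:R * nrm rho P.
Proof.
have sd : (size P^`() <= (size P).-1)%N.
  by rewrite /deriv; apply: leq_trans (size_poly _ _) _; rewrite leqnn.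
rewrite (nrm_widen _ sd) mulr_sumr (@nrm_widen _ P (size P).-1.+1) ?leqSpred //.
rewrite big_ord_recl mulrDr mulr_sumr -[leLHS]add0r; apply: lerD.
  by rewrite mulr_ge0 ?ler0n // mulr_ge0 ?(absv_ge0 Nc) // expr0 ler01.
apply: ler_sum => i _ /=.
rewrite coef_deriv -[P`_i.+1 *+ _]mulr_natl (absvM Nc) (absv_nat Nc) /bump /= add1n exprS.
have -> : rho * (i.+1%:R * nc P`_i.+1 * rho ^+ i) = i.+1%:R * (nc P`_i.+1 * (rho * rho ^+ i)).
  ring.
by rewrite ler_wpM2r // ?ler_nat // mulr_ge0 ?(absv_ge0 Nc) // -exprS.
Qed.

Lemma absv_horner P t : nc P.[t] <= nrm (nc t) P.
Proof.
rewrite horner_coef; apply: le_trans (absv_sum _) _; apply: ler_sum => i _.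
by rewrite (absvM Nc) absvX.
Qed.

(** Each rho^i grows by (tau / rho)^i, at most (tau / rho)^N. This carries the estimate proved at
    one fixed radius to all larger |t|. *)
Lemma nrm_scale tau P N : rho <= tau -> (size P <= N.+1)%N ->
  nrm tau P <= (tau / rho) ^+ N * nrm rho P.
Proof.
move=> rt PN; rewrite !(nrm_widen _ PN) mulr_sumr; apply: ler_sum => i _.
rewrite mulrCA ler_wpM2l ?(absv_ge0 Nc) //.
have -> : tau ^+ i = (tau / rho) ^+ i * rho ^+ i.
  by rewrite -exprMn divfK // gt_eqF.
rewrite ler_wpM2r //; apply: ler_weXn2l; last by rewrite -ltnS.
by rewrite ler_pdivlMr // mul1r.
Qed.

End Radius.

(** Three forms of one fact: from radius [rho] on, the leading term of [a] outweighs the others. The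
    second one makes division by [a] a bounded operation on polynomials. *)
Definition dominant rho a :=
  [/\ nrm rho a <= 2 * nc (lead_coef a) * rho ^+ (size a).-1,
      forall P, nc (lead_coef a) * rho ^+ (size a).-1 / 2 * nrm rho P
                <= nrm rho (a * P)
    & forall t, rho <= nc t ->
        nc (lead_coef a) * nc t ^+ (size a).-1 / 2 <= nc a.[t]].

Lemma dominant_ex a : a != 0 -> exists2 rho0, 1 <= rho0 &
  forall rho, rho0 <= rho -> dominant rho a.
Proof.
move=> a0; set l := nc (lead_coef a); set d := (size a).-1.
have l0 : 0 < l by rewrite absv_gt0 ?lead_coef_eq0.
pose b : {poly K} := take_poly d a.
have aE : a = lead_coef a *: 'X^d + b.
  apply/polyP => i; rewrite coefD coefZ coefXn coef_take_poly.
  case: (ltngtP i d) => [id|di|->]; rewrite ?mulr0 ?add0r ?mulr1 ?addr0 //.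
  by rewrite nth_default //; move: di; rewrite /d; case: (size a).
have sb : (size b <= d)%N by exact: size_take_poly.
have b_small rho : 1 <= rho -> rho * nrm rho b <= rho ^+ d * nrm 1 b.
  move=> r1; rewrite !(nrm_widen _ sb) !mulr_sumr; apply: ler_sum => i _.
  rewrite expr1n mulr1 mulrCA [leRHS]mulrC ler_wpM2l ?(absv_ge0 Nc) //.
  by rewrite -exprS; apply: ler_weXn2l.
(* As [b] has degree below d, its norm is at most rho^(d-1) times its norm at radius 1; beyond this
   radius that is at most half of the leading term l rho^d. *)
exists (Num.max 1 (2 * nrm 1 b / l)); first by rewrite le_max lexx.
have {b_small}bP rho : Num.max 1 (2 * nrm 1 b / l) <= rho ->
    nrm rho b <= l * rho ^+ d / 2.
  rewrite ge_max => /andP[r1 rb].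
  have r0 : 0 < rho by exact: lt_le_trans r1.
  have rd : 0 <= rho ^+ d by rewrite exprn_ge0 // ltW.
  rewrite -(ler_pM2l r0); apply: le_trans (b_small _ r1) _.
  move: rb; rewrite ler_pdivrMr // => rb.
  have := ler_wpM2l rd rb; lra.
move=> rho rrho; have r1 : 1 <= rho by move: rrho; rewrite ge_max => /andP[].
have r0 : 0 < rho by exact: lt_le_trans r1.
have rd : 0 <= rho ^+ d by rewrite exprn_ge0 // ltW.
have bb := bP _ rrho; split.
- rewrite [in leLHS]aE; apply: le_trans (nrmD r1 _ _) _.
  rewrite nrmZ -[X in nc _ * nrm rho X]mulr1 nrmXnM nrm1 -/l mulr1.
  have := mulr_ge0 (ltW l0) rd; lra.
- move=> P; have -> : l * rho ^+ d / 2 * nrm rho P =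
    l * rho ^+ d * nrm rho P - l * rho ^+ d / 2 * nrm rho P by field.
  have <- : nrm rho (lead_coef a *: 'X^d * P) = l * rho ^+ d * nrm rho P.
    by rewrite -scalerAl nrmZ nrmXnM mulrA.
  have -> : lead_coef a *: 'X^d * P = a * P - b * P by rewrite {2}aE; ring.
  rewrite lerBlDr; apply: le_trans (nrmB r1 _ _) _; rewrite lerD2l.
  apply: le_trans (nrmM r1 _ _) _; rewrite ler_wpM2r //; exact: nrm_ge0.
- move=> t rt; have := bP _ (le_trans rrho rt) => bt.
  have {}bt := le_trans (absv_horner b t) bt.
  have : l * nc t ^+ d <= nc a.[t] + nc b.[t].
    rewrite -(absvN Nc b.[t]); apply: le_trans (absvD Nc _ _).
    have -> : a.[t] = lead_coef a * t ^+ d + b.[t].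
      by rewrite {1}aE hornerD hornerZ hornerXn.
    by rewrite addrK (absvM Nc) absvX.
  by move: bt; move: (nc b.[t]) (nc a.[t]) (l * _) => x y w; lra.
Qed.

(** * A priori estimate for the linear operator *)

Section APriori.
Variables (q : {poly K}) (n lam : nat).
Hypothesis q_monic : q \is monic.
Local Notation e := (size q).-1.

Let q0 : q != 0. Proof. exact: monic_neq0. Qed.

Section Estimates.
Variables (rho eps : R).
Hypotheses (rho1 : 1 <= rho) (eps0 : 0 <= eps) (eps1 : eps <= 1).
Hypothesis dq : dominant rho q.
Hypothesis eps_rho : (4 * (size q * (lam + n)))%:R <= eps * rho.

Let r := rho ^+ e.
Let rho0 : 0 < rho. Proof. exact: lt_le_trans rho1. Qed.
Let r0 : 0 < r. Proof. by rewrite exprn_gt0. Qed.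
Let nrm_q : nrm rho q <= 2 * r.
Proof. by have [+ _ _] := dq; rewrite (monicP q_monic) absv1 mulr1. Qed.

(* Differentiating a polynomial of degree [O(k)] costs a factor [O(k / rho)]
   only, because the norm is taken on a disc of radius [rho]. *)
Lemma nrm_num_lower m k P : (m <= (lam + n) * k)%N ->
  (size P <= size q * m + 1)%N ->
  nrm rho (q * P^`() - m%:R *: (q^`() * P)) <= eps * k%:R * r * nrm rho P.
Proof.
move=> mk sP; have P0 := nrm_ge0 rho1 P.
have h1 := nrm_deriv rho1 P; have h2 := nrm_deriv rho1 q.
have h3 := nrmM rho1 q P^`(); have h4 := nrmM rho1 q^`() P.
rewrite -(ler_pM2l rho0).
apply: le_trans (_ : _ <= rho * (nrm rho q * nrm rho P^`() +
    m%:R * (nrm rho q^`() * nrm rho P))) _.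
  rewrite ler_pM2l //; apply: le_trans (nrmB rho1 _ _) _.
  by rewrite nrmZ (absv_nat Nc) lerD // ler_wpM2l ?ler0n.
have {h1}h1 : rho * nrm rho P^`() <= (size q * m)%:R * nrm rho P.
  apply: le_trans h1 _; rewrite ler_wpM2r // ler_nat; move: sP; size_lia.
have {h2}h2 : rho * nrm rho q^`() <= (size q)%:R * (2 * r).
  apply: le_trans h2 _; apply: ler_pM; rewrite ?ler0n ?nrm_ge0 // ler_nat.
  exact: leq_pred.
have g1 : nrm rho q * (rho * nrm rho P^`()) <= 2 * r * ((size q * m)%:R * nrm rho P).
  by apply: ler_pM; rewrite ?nrm_ge0 // mulr_ge0 ?nrm_ge0 // ltW.
have g2 : m%:R * nrm rho P * (rho * nrm rho q^`())
    <= m%:R * nrm rho P * ((size q)%:R * (2 * r)).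
  by rewrite ler_wpM2l // mulr_ge0.
(* Each of the two products contributes 2 r (size q) m times the norm of P, whence the 4 in
   [eps_rho]. *)
have g3 : (4 * (size q * m))%:R <= eps * rho * k%:R :> R.
  apply: le_trans (ler_wpM2r (ler0n _ k) eps_rho); rewrite -natrM ler_nat.
  by rewrite -!mulnA !leq_mul2l mk !orbT.
have g4 := ler_wpM2r (mulr_ge0 (ltW r0) P0) g3.
move: g1 g2 g4; rewrite !natrM; lra.
Qed.

(** The base 4 is 2 + 2: passing from j to j + 1 multiplies the old error by at most 2 k r, and adds
    at most eps k r times the norm of the j-th numerator, itself at most 2 4^j (k r)^j times the
    norm of P. *)
Lemma nrm_twder_num_lower M k P j : (M <= lam * k)%N -> (0 < k)%N -> (j <= n)%N ->
  (size P <= size q * M + 1)%N ->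
  nrm rho (twder_num q M k P j - k%:R ^+ j *: (q ^+ j * P))
    <= eps * 4 ^+ j * (k%:R * r) ^+ j * nrm rho P.
Proof.
move=> Mk k0 + sP; have P0 := nrm_ge0 rho1 P.
have kr0 m : 0 <= (k%:R * r) ^+ m by rewrite exprn_ge0 // mulr_ge0 // ltW.
elim: j => [|j IH] jn.
  by rewrite /= !expr0 mul1r scale1r subrr nrm0 !mulr1 mulr_ge0.
have {}IH := IH (ltnW jn).
set V := twder_num q M k P j in IH *.
have sV : (size V <= size q * (M + j) + 1)%N.
  apply: leq_trans (size_twder_num q0 _ _ _ _) _.
  have : (e * j <= size q * j)%N by rewrite leq_mul2r leq_pred orbT.
  by move=> /(leq_add sP)/leq_trans -> //; rewrite mulnDr addnAC.
have nV : nrm rho V <= (eps * 4 ^+ j + 2 ^+ j) * ((k%:R * r) ^+ j * nrm rho P).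
  have -> : V = (V - k%:R ^+ j *: (q ^+ j * P)) + k%:R ^+ j *: (q ^+ j * P).
    by rewrite subrK.
  apply: le_trans (nrmD rho1 _ _) _; rewrite mulrDl mulrA; apply: lerD => //.
  rewrite nrmZ absvX (absv_nat Nc) exprMn.
  have -> : 2 ^+ j * (k%:R ^+ j * r ^+ j * nrm rho P)
      = k%:R ^+ j * ((2 * r) ^+ j * nrm rho P) by rewrite exprMn; ring.
  rewrite ler_wpM2l ?exprn_ge0 //; apply: le_trans (nrmM rho1 _ _) _.
  rewrite ler_wpM2r //; apply: le_trans (nrm_exp rho1 _ _) _.
  by apply: lerXn2r; rewrite // nnegrE ?nrm_ge0 // mulr_ge0 // ltW.
rewrite /= -/V.
have -> : k%:R *: (q * V) + (q * V^`() - (M + j)%:R *: (q^`() * V))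
    - k%:R ^+ j.+1 *: (q ^+ j.+1 * P)
  = k%:R *: (q * (V - k%:R ^+ j *: (q ^+ j * P)))
    + (q * V^`() - (M + j)%:R *: (q^`() * V)).
  rewrite -!mul_polyC !exprS polyCM; ring.
apply: le_trans (nrmD rho1 _ _) _.
have Mjk : (M + j <= (lam + n) * k)%N.
  by rewrite mulnDl leq_add // (leq_trans (ltnW jn)) // leq_pmulr.
have h1 := nrm_num_lower Mjk sV.
rewrite nrmZ (absv_nat Nc).
have h2 := nrmM rho1 q (V - k%:R ^+ j *: (q ^+ j * P)).
set W := V - _ in IH h2 *.
have h3 : nrm rho q * nrm rho W <= 2 * r * nrm rho W.
  by rewrite ler_wpM2r // nrm_ge0.
set X := (k%:R * r) ^+ j * nrm rho P.
have X0 : 0 <= X by rewrite mulr_ge0.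
have kr : 0 <= k%:R * r :> R by rewrite mulr_ge0 // ltW.
have -> : eps * 4 ^+ j.+1 * (k%:R * r) ^+ j.+1 * nrm rho P
  = k%:R * r * (eps * (4 * 4 ^+ j) * X) by rewrite /X !exprS; ring.
have IH' : nrm rho W <= eps * 4 ^+ j * X by rewrite /X mulrA.
have nV' : nrm rho V <= (4 ^+ j + 4 ^+ j) * X.
  apply: le_trans nV _; rewrite -/X ler_wpM2r // lerD //.
    by rewrite ler_piMl // exprn_ge0.
  by apply: lerXn2r; rewrite ?nnegrE // ler_nat.
apply: le_trans (_ : _ <= k%:R * r * (2 * (eps * 4 ^+ j * X)) +
   k%:R * r * (eps * ((4 ^+ j + 4 ^+ j) * X))) _; last by lra.
apply: lerD.
  rewrite -mulrA ler_wpM2l //; apply: le_trans h2 _; apply: le_trans h3 _.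
  have -> : 2 * r * nrm rho W = r * (2 * nrm rho W) by ring.
  by rewrite !ler_pM2l.
apply: le_trans h1 _.
have -> : eps * k%:R * r * nrm rho V = k%:R * r * (eps * nrm rho V) by ring.
by rewrite ler_wpM2l // ler_wpM2l.
Qed.

Lemma nrm_twder_num M k P j : (M <= lam * k)%N -> (0 < k)%N -> (j <= n)%N ->
  (size P <= size q * M + 1)%N ->
  nrm rho (twder_num q M k P j) <= 2 * 4 ^+ j * (k%:R * r) ^+ j * nrm rho P.
Proof.
move=> Mk k0 jn sP; have h := nrm_twder_num_lower Mk k0 jn sP.
have P0 := nrm_ge0 rho1 P.
rewrite -[twder_num _ _ _ _ _](subrK (k%:R ^+ j *: (q ^+ j * P))).
apply: le_trans (nrmD rho1 _ _) _.
have {}h : nrm rho (twder_num q M k P j - k%:R ^+ j *: (q ^+ j * P))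
    <= 4 ^+ j * (k%:R * r) ^+ j * nrm rho P.
  apply: le_trans h _; rewrite -!mulrA ler_piMl //.
  by rewrite !mulr_ge0 ?exprn_ge0 // mulr_ge0 // ltW.
suff : nrm rho (k%:R ^+ j *: (q ^+ j * P)) <= 4 ^+ j * (k%:R * r) ^+ j * nrm rho P by lra.
rewrite nrmZ absvX (absv_nat Nc).
apply: le_trans (_ : _ <= k%:R ^+ j * ((2 * r) ^+ j * nrm rho P)) _.
  rewrite ler_wpM2l ?exprn_ge0 //; apply: le_trans (nrmM rho1 _ _) _.
  rewrite ler_wpM2r //; apply: le_trans (nrm_exp rho1 _ _) _.
  by apply: lerXn2r; rewrite // nnegrE ?nrm_ge0 // mulr_ge0 // ltW.
have -> : k%:R ^+ j * ((2 * r) ^+ j * nrm rho P) = 2 ^+ j * ((k%:R * r) ^+ j * nrm rho P).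
  by rewrite !exprMn; ring.
rewrite -[leRHS]mulrA; apply: ler_wpM2r.
  by rewrite mulr_ge0 // exprn_ge0 // mulr_ge0 // ltW.
by apply: lerXn2r; rewrite ?nnegrE // ler_nat.
Qed.

End Estimates.

End APriori.
End CoefficientNorm.

Section APrioriEstimate.
Variables (K : numFieldType) (R : archiRealFieldType) (nc : K -> R).
Hypothesis Nc : abs_value nc.
Variables (q : {poly K}) (n : nat) (a : 'I_n.+1 -> {poly K}) (lam : nat).
Hypotheses (q_monic : q \is monic) (an0 : a ord_max != 0).

(** In units of k^n times the norm of P: the main term a_n k^n q^n P counts for at least 2 c0, the
    error of replacing the top iterate by k^n q^n P for at most c0, and the terms j < n for at most
    c0 / 2 once k is large. What is left is c0 / 2. *)
Lemma nrm_diffop_lower : exists rho c C : R, exists k1 : nat,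
  [/\ 1 <= rho, 0 < c, dominant nc rho q &
    forall k M (P : {poly K}), (k1 < k)%N -> (M <= lam * k)%N ->
      (size P <= size q * M + 1)%N ->
      c * k%:R ^+ n * nrm nc rho P <= nrm nc rho (diffop_num q a M k P) /\
      forall j, (j <= n)%N ->
        nrm nc rho (twder_num q M k P j) <= C * k%:R ^+ n * nrm nc rho P].
Proof.
have q0 : q != 0 by exact: monic_neq0.
have [rq rq1 rqP] := dominant_ex Nc q0.
have [ra ra1 raP] := dominant_ex Nc an0.
(* This value turns the bound 2 l eps 4^n (k r)^n of the error term into exactly c0 k^n, as computed
   in [e2]. *)
pose eps : R := (8 * 8 ^+ n)^-1.
have eps0 : 0 < eps by rewrite invr_gt0 mulr_gt0 // exprn_gt0.
have eps1 : eps <= 1.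
  by rewrite invf_le1 ?mulr_gt0 ?exprn_gt0 // mulr_ege1 ?exprn_ege1 // ler1n.
pose rho := Num.max (Num.max rq ra) ((4 * (size q * (lam + n)))%:R / eps).
have rhoq : rq <= rho by rewrite /rho !le_max lexx.
have rhoa : ra <= rho by rewrite /rho !le_max lexx orbT.
have rho_eps : (4 * (size q * (lam + n)))%:R <= eps * rho.
  by rewrite mulrC -ler_pdivrMr // /rho le_max lexx orbT.
have rho1 : 1 <= rho by exact: le_trans rhoq.
have rho0 : 0 < rho by exact: lt_le_trans rho1.
have dq := rqP _ rhoq; have da := raP _ rhoa.
pose r : R := rho ^+ (size q).-1; have r0 : 0 < r by rewrite exprn_gt0.
set l := nc (lead_coef (a ord_max)) * rho ^+ (size (a ord_max)).-1.
have l0 : 0 < l by rewrite mulr_gt0 ?exprn_gt0 // (absv_gt0 Nc) // lead_coef_eq0.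
pose c0 := l * r ^+ n / 2 ^+ n / 4.
have c00 : 0 < c0.
  by rewrite divr_gt0 // divr_gt0 ?exprn_gt0 // mulr_gt0 // exprn_gt0.
(* The terms j < n carry at most k^(n-1), so their total is at most S k^(n-1) times the norm of P; k
   beyond 2 S / c0 brings it under the share c0 / 2. *)
pose S := \sum_(j < n) nrm nc rho (a (widen_ord (leqnSn n) j)) *
   ((2 * r) ^+ (n - j) * (2 * 4 ^+ j * r ^+ j)).
have S0 : 0 <= S.
  apply: sumr_ge0 => j _; rewrite !mulr_ge0 ?(nrm_ge0 Nc) ?exprn_ge0 //.
  - by rewrite mulr_ge0 // ltW.
  - exact: ltW.
exists rho, (c0 / 2), (2 * 4 ^+ n * (1 + r) ^+ n), (Num.bound (2 * S / c0)).
split=> //; first by rewrite divr_gt0.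
move=> k M P k1k Mk sP; set N := nrm nc rho P; have N0 : 0 <= N by exact: nrm_ge0.
have k0 : (0 < k)%N by exact: leq_ltn_trans k1k.
have k1 : 1 <= k%:R :> R by rewrite ler1n.
have kS : 2 * S <= c0 * k%:R.
  have SC : 0 <= 2 * S / c0 by apply: divr_ge0; [exact: mulr_ge0 | exact: ltW].
  rewrite [leRHS]mulrC -ler_pdivrMr //.
  apply: le_trans (ltW (archi_boundP SC)) _.
  by rewrite ler_nat ltnW.
have numP j : (j <= n)%N -> nrm nc rho (twder_num q M k P j)
    <= 2 * 4 ^+ j * (k%:R * r) ^+ j * N.
  by move=> jn; exact: (nrm_twder_num Nc q_monic rho1 (ltW eps0) eps1 dq rho_eps
    Mk k0 jn sP).
have lowP := nrm_twder_num_lower Nc q_monic rho1 (ltW eps0)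
  eps1 dq rho_eps Mk k0 (leqnn n) sP.
rewrite -/r in lowP; rewrite -/N in lowP.
split; last first.
  move=> j jn; apply: le_trans (numP _ jn) _; rewrite ler_wpM2r //.
  have -> : 2 * 4 ^+ j * (k%:R * r) ^+ j = 2 * 4 ^+ j * r ^+ j * k%:R ^+ j.
    by rewrite exprMn; ring.
  have rj : r ^+ j <= (1 + r) ^+ n.
    apply: le_trans (_ : _ <= (1 + r) ^+ j) _.
      by apply: lerXn2r; rewrite ?nnegrE ?addr_ge0 // ?(ltW r0) // lerDr.
    by apply: ler_weXn2l; rewrite // lerDl ltW.
  have j4 : 4 ^+ j <= 4 ^+ n :> R by apply: ler_weXn2l; rewrite // ler1n.
  have x0 : 0 <= 2 * 4 ^+ j :> R by rewrite mulr_ge0 // exprn_ge0.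
  have y0 : 0 <= r ^+ j by rewrite exprn_ge0 // ltW.
  have z0 : 0 <= k%:R ^+ j :> R by rewrite exprn_ge0.
  have kj : k%:R ^+ j <= k%:R ^+ n :> R by exact: ler_weXn2l.
  have j42 : 2 * 4 ^+ j <= 2 * 4 ^+ n :> R by rewrite ler_wpM2l.
  exact: (ler_pM (mulr_ge0 x0 y0) z0 (ler_pM x0 y0 j42 rj) kj).
set Q := diffop_num q a M k P.
set V := twder_num q M k P n - k%:R ^+ n *: (q ^+ n * P) in lowP.
pose T := \sum_(j < n) a (widen_ord (leqnSn n) j) * q ^+ (n - j) *
  twder_num q M k P j.
have QE : a ord_max * (k%:R ^+ n *: (q ^+ n * P)) = Q - (a ord_max * V + T).
  rewrite /Q /diffop_num big_ord_recr /= -/T subnn expr0 mulr1 /V; ring.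
have nT : k%:R * nrm nc rho T <= S * k%:R ^+ n * N.
  apply: le_trans (ler_wpM2l (ler0n _ k) (nrm_sum Nc rho1 _ _)) _.
  rewrite mulr_sumr -mulrA mulr_suml; apply: ler_sum => j _.
  have jn : (j <= n)%N by exact: ltnW.
  have h1 : nrm nc rho (q ^+ (n - j)) <= (2 * r) ^+ (n - j).
    apply: le_trans (nrm_exp Nc rho1 _ _) _; apply: lerXn2r; rewrite ?nnegrE ?(nrm_ge0 Nc) //.
      by rewrite mulr_ge0 // ltW.
    by have [+ _ _] := dq; rewrite (monicP q_monic) (absv1 Nc) mulr1.
  set A := nrm nc rho (a _).
  apply: le_trans (_ : _ <= k%:R * (A * (2 * r) ^+ (n - j) *
      (2 * 4 ^+ j * (k%:R * r) ^+ j * N))) _.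
    rewrite ler_wpM2l //; apply: le_trans (nrmM Nc rho1 _ _) _.
    apply: ler_pM; rewrite ?(nrm_ge0 Nc) //; last exact: numP.
    by apply: le_trans (nrmM Nc rho1 _ _) _; rewrite ler_wpM2l // (nrm_ge0 Nc).
  have -> : k%:R * (A * (2 * r) ^+ (n - j) * (2 * 4 ^+ j * (k%:R * r) ^+ j * N)) =
     A * ((2 * r) ^+ (n - j) * (2 * 4 ^+ j * r ^+ j)) * (k%:R ^+ j.+1 * N).
    by rewrite [(k%:R * r) ^+ j]exprMn exprS; ring.
  rewrite ler_wpM2l // ?ler_wpM2r //; last exact: ler_weXn2l.
  rewrite !mulr_ge0 ?(nrm_ge0 Nc) ?exprn_ge0 // ?mulr_ge0 // ltW //.
have h1 : l / 2 * (k%:R ^+ n * ((r / 2) ^+ n * N)) <=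
    nrm nc rho (a ord_max * (k%:R ^+ n *: (q ^+ n * P))).
  have [_ dal _] := da; apply: le_trans (dal _); rewrite -/l.
  apply: ler_wpM2l; first by rewrite divr_ge0 // ltW.
  rewrite (nrmZ Nc) (absvX Nc) (absv_nat Nc) ler_wpM2l ?exprn_ge0 //.
  elim: (n) => [|i IH]; first by rewrite !expr0 !mul1r.
  have [_ dql _] := dq; rewrite !exprS -!mulrA; apply: le_trans (dql _).
  rewrite (monicP q_monic) (absv1 Nc) mul1r -/r -mulrA; apply: ler_wpM2l; first exact: ltW.
  by rewrite ler_wpM2l.
have h2 : nrm nc rho (a ord_max * V) <= 2 * l * (eps * 4 ^+ n * (k%:R * r) ^+ n * N).
  apply: le_trans (nrmM Nc rho1 _ _) _; apply: ler_pM; rewrite ?(nrm_ge0 Nc) //.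
  by have [+ _ _] := da; rewrite mulrA.
have h3 : nrm nc rho (Q - (a ord_max * V + T)) <=
    nrm nc rho Q + (nrm nc rho (a ord_max * V) + nrm nc rho T).
  apply: le_trans (nrmB Nc rho1 _ _) _; rewrite lerD2l; exact: nrmD.
have e1 : l / 2 * (k%:R ^+ n * ((r / 2) ^+ n * N)) = 2 * c0 * k%:R ^+ n * N.
  by rewrite /c0 expr_div_n; field; rewrite expf_neq0.
have e2 : 2 * l * (eps * 4 ^+ n * (k%:R * r) ^+ n * N) = c0 * k%:R ^+ n * N.
  rewrite /c0 /eps exprMn (_ : 8 = 2 * 4 :> R) ?(exprMn _ 2 4) -?natrM //.
  by field; rewrite !expf_neq0.
have h4 : nrm nc rho T <= c0 / 2 * k%:R ^+ n * N.
  rewrite -(ler_pM2l (_ : 0 < k%:R)) ?ltr0n //; apply: le_trans nT _.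
  have kN : 0 <= k%:R ^+ n * N by rewrite mulr_ge0 // exprn_ge0.
  rewrite -[leLHS]mulrA -(mulrA (c0 / 2)); have := ler_wpM2r kN kS.
  by move: (k%:R ^+ n * N) => Y; lra.
rewrite QE e1 -!(mulrA _ _ N) in h1; rewrite e2 -!(mulrA _ _ N) in h2.
rewrite -!(mulrA _ _ N) in h4 *; move: h1 h2 h3 h4.
by move: (k%:R ^+ n * N) => Y; lra.
Qed.

End APrioriEstimate.

(** * Polynomial expressions in power series *)

Section FpsCoef.
Variable A : comNzRingType.
Implicit Types f g : fps A.

Lemma fcoefD f g k : fcoef (f + g) k = fcoef f k + fcoef g k.
Proof. by []. Qed.
Lemma fcoefM f g k :
  fcoef (f * g) k = \sum_(i < k.+1) fcoef f i * fcoef g (k - i).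
Proof. by []. Qed.
Lemma fcoefCM (c : A) f k : fcoef (fpsC c * f) k = c * fcoef f k.
Proof.
rewrite fcoefM big_ord_recl /= subn0 big1 ?addr0 // => i _.
by rewrite /= mul0r.
Qed.
Lemma fcoefXM f k : fcoef (fpsX A * f) k.+1 = fcoef f k.
Proof.
rewrite fcoefM !big_ord_recl /= mul0r add0r mul1r subn1 big1 ?addr0 // => i _.
by rewrite /= mul0r.
Qed.
End FpsCoef.

(** Polynomial expressions in x and the [v j] with constants in [S], given by generators so that
    levels and norm bounds follow by structural induction. *)
Inductive fps_gen (A : comNzRingType) (S : A -> Prop) (n : nat)
    (v : 'I_n -> fps A) : fps A -> Prop :=
| fps_gen_const c : S c -> fps_gen S v (fpsC c)
| fps_genX : fps_gen S v (fpsX A)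
| fps_gen_var j : fps_gen S v (v j)
| fps_gen_add f g : fps_gen S v f -> fps_gen S v g -> fps_gen S v (f + g)
| fps_gen_mul f g : fps_gen S v f -> fps_gen S v g -> fps_gen S v (f * g).

Lemma convolution_le (R : realFieldType) (x y : nat -> R) k :
  (forall i, 0 <= x i) -> (forall i, 0 <= y i) ->
  \sum_(i < k) \sum_(a < i.+1) x a * y (i - a)%N
    <= (\sum_(i < k) x i) * (\sum_(i < k) y i).
Proof.
move=> x0 y0.
have -> : \sum_(i < k) \sum_(a < i.+1) x a * y (i - a)%N =
          \sum_(a < k) \sum_(i < k | (a <= i)%N) x a * y (i - a)%N.
  rewrite (exchange_big_dep xpredT) //=; apply: eq_bigr => i _.
  rewrite (big_ord_widen k (fun a => x a * y (i - a)%N)) //.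
rewrite mulr_suml; apply: ler_sum => a _; rewrite -mulr_sumr ler_wpM2l //.
have -> : \sum_(i < k | (a <= i)%N) y (i - a)%N = \sum_(0 <= i < k - a) y i.
  rewrite -(big_mkord (fun i => a <= i)%N (fun i => y (i - a)%N)).
  rewrite (big_cat_nat (n := a)) //=; last exact: ltnW.
  rewrite big_nat_cond big1 ?add0r => [|i /andP[/andP[_ ia] ai]]; last first.
    by move: ia; rewrite ltnNge ai.
  rewrite -{1}[nat_of_ord a]add0n big_addn big_nat_cond [RHS]big_nat_cond.
  by apply: eq_big => i; [rewrite leq_addl andbT|rewrite addnK].
rewrite -(big_mkord xpredT y) [leRHS](big_cat_nat (n := (k - a)%N)) ?leq_subr //=.
by rewrite lerDl sumr_ge0.
Qed.

Section Levels.
Variables (K : numFieldType) (F : fieldType).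
Variables (iota : {rmorphism {poly K} -> F}) (D : F -> F).
Hypothesis DF : frac_deriv iota D.
Variable q : {poly K}.
Hypothesis q0 : q != 0.
Local Notation in_level := (in_level iota q).

Lemma size_mul_exp (P : {poly K}) m :
  (size (P * q ^+ m)%R <= size P + (size q).-1 * m)%N.
Proof.
apply: leq_trans (size_polyMleq _ _) _.
by rewrite -[size (q ^+ m)]prednK ?size_poly_gt0 ?expf_neq0 // size_exp addnS.
Qed.

Lemma in_level0 M : in_level M 0.
Proof. by exists 0; rewrite ?mul0r ?rmorph0 ?size_poly0. Qed.

Lemma in_level_le M M' u : (M <= M')%N -> in_level M u -> in_level M' u.
Proof.
move=> MM [P uP sP]; exists (P * q ^+ (M' - M)).
  by rewrite rmorphM rmorphXn -uP -mulrA -exprD subnKC.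
apply: leq_trans (size_mul_exp _ _) _; rewrite -[in X in (_ <= X)%N](subnKC MM) mulnDr.
rewrite addnAC; apply: leq_add => //.
by rewrite leq_mul2r leq_pred orbT.
Qed.

Lemma in_levelD M u v : in_level M u -> in_level M v -> in_level M (u + v).
Proof.
move=> [P uP sP] [Q vQ sQ]; exists (P + Q); first by rewrite mulrDl uP vQ rmorphD.
by apply: leq_trans (size_polyD _ _) _; rewrite geq_max sP sQ.
Qed.

Lemma in_levelM M M' u v :
  in_level M u -> in_level M' v -> in_level (M + M') (u * v).
Proof.
move=> [P uP sP] [Q vQ sQ]; exists (P * Q).
  by rewrite exprD mulrACA uP vQ rmorphM.
apply: leq_trans (size_polyMleq _ _) _.
have := leq_add sP sQ; rewrite mulnDr; fold_size.
by move: (_ * M)%N (_ * M')%N => x y; lia.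
Qed.

Lemma in_level_sum M m (u : 'I_m -> F) :
  (forall i, in_level M (u i)) -> in_level M (\sum_i u i).
Proof.
move=> uM; elim/big_ind : _ => //; first exact: in_level0.
by move=> *; exact: in_levelD.
Qed.

Lemma in_level_iota (P : {poly K}) : in_level (size P) (iota P).
Proof.
exists (P * q ^+ size P); first by rewrite rmorphM rmorphXn.
apply: leq_trans (size_mul_exp _ _) _; rewrite -mulSn prednK ?size_poly_gt0 //.
exact: leq_addr.
Qed.

Lemma in_level1 M : in_level M 1.
Proof.
apply: (@in_level_le 0) => //; exists 1; first by rewrite mulr1 rmorph1.
by rewrite size_poly1 muln0.
Qed.

Lemma in_level_twder n j k M u : (j <= n)%N -> in_level M u ->
  in_level (M + n) (iter j (twder D k) u).
Proof.
move=> jn [P uP sP]; apply: (@in_level_le (M + j)); first by rewrite leq_add2l.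
exists (twder_num q M k P j); first exact: (twder_numP DF).
apply: leq_trans (size_twder_num q0 _ _ _ _) _.
rewrite mulnDr addnAC; apply: leq_add => //.
by rewrite leq_mul2r leq_pred orbT.
Qed.

Variables (R : realFieldType) (nc : K -> R).
Hypothesis Nc : abs_value nc.
Variables (n m : nat) (v : 'I_m -> fps F).
Let S (c : F) := exists P, c = iota P.

(** The order of the quantifiers matters: [mu] precedes [lam], so [lam] may be chosen from [mu]; [C]
    precedes [X], so [X] may be chosen from [C]. Both parts look only at indices up to [k], as
    needed in inductions where the later coefficients are still uncontrolled. *)
Lemma fps_gen_level G : fps_gen S v G -> exists mu,
  (forall lam k,
    (forall i j, (i <= k)%N -> in_level (lam * i + n) (fcoef (v j) i)) ->
    forall i, (i <= k)%N -> in_level (lam * i + mu) (fcoef G i)) /\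
  (forall lam rho, 1 <= rho -> exists2 C, 0 <= C & forall X k V,
     0 <= X <= 1 ->
     (forall i j, (i <= k)%N ->
        fcoef (v j) i * iota q ^+ (lam * i + n) = iota (V j i)) ->
     (forall j, \sum_(i < k.+1) nrm nc rho (V j i) * X ^+ i <= 1) ->
     exists2 W, forall i, (i <= k)%N ->
        fcoef G i * iota q ^+ (lam * i + mu) = iota (W i)
      & \sum_(i < k.+1) nrm nc rho (W i) * X ^+ i <= C).
Proof.
elim=> {G} [c [P ->]||j|f g _ [mu [Lf Nf]] _ [nu [Lg Ng]]|f g _ [mu [Lf Nf]] _ [nu [Lg Ng]]].
- exists (size P); split=> [lam k _ i _|lam rho rho1] /=.
    case: eqP => _; last exact: in_level0.
    by apply: in_level_le (in_level_iota P); exact: leq_addl.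
  exists (nrm nc rho (P * q ^+ size P)); first exact: nrm_ge0.
  move=> X k V _ _ _; exists (fun i => if i == 0%N then P * q ^+ size P else 0).
    move=> i _; case: eqP => [->|_]; last by rewrite mul0r rmorph0.
    by rewrite muln0 rmorphM rmorphXn.
  rewrite big_ord_recl /= expr0 mulr1 big1 ?addr0 // => i _.
  by rewrite nrm0 mul0r.
- exists 0%N; split=> [lam k _ i _|lam rho rho1] /=.
    by case: eqP => _; [exact: in_level1|exact: in_level0].
  exists (nrm nc rho (q ^+ lam)); first exact: nrm_ge0.
  move=> X [|k] V /andP[X0 X1] _ _; exists (fun i => if i == 1%N then q ^+ lam else 0).
  + by move=> [|i] //= _; rewrite mul0r rmorph0.
  + by rewrite big_ord1 /= nrm0 mul0r; exact: nrm_ge0.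
  + move=> i _; case: eqP => [->|_]; last by rewrite mul0r rmorph0.
    by rewrite muln1 addn0 mul1r rmorphXn.
  rewrite big_ord_recl big_ord_recl /= nrm0 mul0r add0r big1 ?addr0 => [|i _].
    by rewrite expr1 ler_piMr // nrm_ge0.
  by rewrite mul0r.
- exists n; split=> [lam k vl i ik|lam rho rho1]; first exact: vl.
  by exists 1; rewrite ?ler01 // => X k V _ vV sV; exists (V j) => // i ik; exact: vV.
- exists (mu + nu)%N; split=> [lam k vl i ik|lam rho rho1].
    rewrite fcoefD; apply: in_levelD.
      by apply: in_level_le (Lf _ _ vl _ ik); rewrite addnA leq_addr.
    by apply: in_level_le (Lg _ _ vl _ ik); rewrite addnCA leq_addl.
  have [C C0 Cf] := Nf lam rho rho1; have [C' C'0 Cg] := Ng lam rho rho1.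
  exists (C * nrm nc rho (q ^+ nu) + C' * nrm nc rho (q ^+ mu)).
    by rewrite addr_ge0 // mulr_ge0 // nrm_ge0.
  move=> X k V X01 vV sV; have [Wf fW sf] := Cf X k V X01 vV sV.
  have [Wg gW sg] := Cg X k V X01 vV sV; have /andP[X0 X1] := X01.
  exists (fun i => Wf i * q ^+ nu + Wg i * q ^+ mu).
    move=> i ik; rewrite fcoefD mulrDl rmorphD !rmorphM !rmorphXn -fW // -gW //.
    by rewrite !exprD; ring.
  apply: le_trans (lerD (ler_wpM2r (nrm_ge0 Nc rho1 (q ^+ nu)) sf)
    (ler_wpM2r (nrm_ge0 Nc rho1 (q ^+ mu)) sg)).
  rewrite !mulr_suml -big_split /=; apply: ler_sum => i _.
  rewrite mulrAC [X in _ <= _ + X]mulrAC -mulrDl ler_wpM2r ?exprn_ge0 //.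
  by apply: le_trans (nrmD Nc rho1 _ _) _; rewrite lerD // nrmM.
- exists (mu + nu)%N; split=> [lam k vl i ik|lam rho rho1].
    rewrite fcoefM; apply: in_level_sum => a.
    have ai : (a <= i)%N by rewrite -ltnS.
    have -> : (lam * i + (mu + nu) = lam * a + mu + (lam * (i - a) + nu))%N.
      by rewrite -{1}(subnKC ai) mulnDr addnACA.
    apply: in_levelM; [apply: (Lf _ _ vl)|apply: (Lg _ _ vl)].
      exact: leq_trans ik.
    by apply: leq_trans ik; exact: leq_subr.
  have [C C0 Cf] := Nf lam rho rho1; have [C' C'0 Cg] := Ng lam rho rho1.
  exists (C * C'); first exact: mulr_ge0.
  move=> X k V X01 vV sV; have [Wf fW sf] := Cf X k V X01 vV sV.
  have [Wg gW sg] := Cg X k V X01 vV sV; have /andP[X0 X1] := X01.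
  exists (fun i => \sum_(a < i.+1) Wf a * Wg (i - a)%N).
    move=> i ik; rewrite fcoefM mulr_suml rmorph_sum; apply: eq_bigr => a _.
    have ai : (a <= i)%N by rewrite -ltnS.
    have -> : (lam * i + (mu + nu) = lam * a + mu + (lam * (i - a) + nu))%N.
      by rewrite -{1}(subnKC ai) mulnDr addnACA.
    rewrite exprD mulrACA fW ?(leq_trans ai) // gW ?rmorphM //.
    by apply: leq_trans ik; exact: leq_subr.
  pose x i := nrm nc rho (Wf i) * X ^+ i; pose y i := nrm nc rho (Wg i) * X ^+ i.
  have x0 i : 0 <= x i by rewrite mulr_ge0 ?nrm_ge0 ?exprn_ge0.
  have y0 i : 0 <= y i by rewrite mulr_ge0 ?nrm_ge0 ?exprn_ge0.
  apply: le_trans (_ : _ <= (\sum_(i < k.+1) x i) * (\sum_(i < k.+1) y i)) _; last first.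
    by apply: ler_pM => //; apply: sumr_ge0.
  apply: le_trans (convolution_le _ x0 y0); apply: ler_sum => i _.
  apply: le_trans (ler_wpM2r (exprn_ge0 i X0) (nrm_sum Nc rho1 _ _)) _.
  rewrite mulr_suml; apply: ler_sum => a _; rewrite /x /y.
  have ai : (a <= i)%N by rewrite -ltnS.
  have -> : nrm nc rho (Wf a) * X ^+ a * (nrm nc rho (Wg (i - a)%N) * X ^+ (i - a)%N)
    = nrm nc rho (Wf a) * nrm nc rho (Wg (i - a)%N) * X ^+ i.
    by have -> : X ^+ i = X ^+ a * X ^+ (i - a)%N; [rewrite -exprD subnKC | ring].
  by rewrite ler_wpM2r ?exprn_ge0 // nrmM.
Qed.

End Levels.

(** The estimates need polynomial constants. Only finitely many constants enter an expression, so
    one polynomial factor clears them all; sums and products use the product of the two factors. *)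
Lemma fps_gen_clear (K F : fieldType) (iota : {rmorphism {poly K} -> F}) (D : F -> F)
    n (v : 'I_n -> fps F) G : frac_deriv iota D ->
  fps_gen (fun=> True) v G -> exists2 d, d != 0 &
    fps_gen (fun c => exists P, c = iota P) v (fpsC (iota d) * G).
Proof.
move=> DF; have cM c d : fpsC c * fpsC d = fpsC (c * d) :> fps F.
  by apply: fpsP => k; rewrite fcoefCM /=; case: eqP; rewrite ?mulr0.
have one : fpsC 1 = 1 :> fps F by [].
elim=> {G} [c _||j|f g _ [d d0 df] _ [d' d0' dg]|f g _ [d d0 df] _ [d' d0' dg]].
- have [P [Q [Q0 ->]]] := frac_deriv_repr DF c; exists Q => //.
  rewrite cM; apply: fps_gen_const; exists P; rewrite mulrC divfK //.
  by rewrite (iota_eq0 DF).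
- by exists 1; rewrite ?oner_eq0 // rmorph1 one mul1r; exact: fps_genX.
- by exists 1; rewrite ?oner_eq0 // rmorph1 one mul1r; exact: fps_gen_var.
- exists (d * d'); first exact: mulf_neq0.
  have -> : fpsC (iota (d * d')) * (f + g) =
    fpsC (iota d') * (fpsC (iota d) * f) + fpsC (iota d) * (fpsC (iota d') * g).
    by rewrite rmorphM -cM; ring.
  by apply: fps_gen_add; apply: fps_gen_mul => //; apply: fps_gen_const; eexists.
- exists (d * d'); first exact: mulf_neq0.
  have -> : fpsC (iota (d * d')) * (f * g) =
    (fpsC (iota d) * f) * (fpsC (iota d') * g).
    by rewrite rmorphM -cM; ring.
  exact: fps_gen_mul.
Qed.

(** * Growth of rational solutions of the recursion *)

Lemma squarefree_radical (K : numClosedFieldType) (a : {poly K}) : a != 0 ->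
  exists q : {poly K}, [/\ q \is monic, forall s, root a s -> root q s
    & forall s, root q s -> q^`().[s] != 0].
Proof.
move=> a0; have [rs aE] := closed_field_poly_normal a.
pose q := \prod_(z <- undup rs) ('X - z%:P).
exists q; split.
- exact: monic_prod_XsubC.
- move=> s; rewrite aE rootZ ?lead_coef_eq0 // root_prod_XsubC => srs.
  by rewrite root_prod_XsubC mem_undup.
move=> s; rewrite root_prod_XsubC => srs.
rewrite /q (big_rem s srs) /= derivM derivXsubC mul1r !hornerE subrr mul0r addr0.
rewrite -rootE root_prod_XsubC mem_rem_uniq ?undup_uniq // inE eqxx //.
Qed.

Lemma sum_indicator_le (R : realFieldType) (t : nat -> R) m N :
  (forall i, 0 <= t i) ->
  \sum_(i < m) (if (i < N)%N then t i else 0) <= \sum_(i < N) t i.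
Proof.
move=> t0; rewrite -big_mkcond /=.
have [mN|/ltnW Nm] := leqP m N; last by rewrite -(big_ord_widen m t).
rewrite (eq_bigl xpredT) => [|i]; last by rewrite (leq_trans (ltn_ord i) mN).
rewrite (big_ord_widen N t mN) [leRHS](bigID (fun i : 'I_N => (i < m)%N)) /=.
by rewrite lerDl sumr_ge0.
Qed.

Section Convergence.
Variables (K : numClosedFieldType) (F : fieldType).
Variables (iota : {rmorphism {poly K} -> F}) (D : F -> F).
Hypothesis DF : frac_deriv iota D.
Variables (R : archiRealFieldType) (nc : K -> R).
Hypothesis Nc : abs_value nc.
Variables (n : nat) (a : 'I_n.+1 -> {poly K}).
Hypothesis an0 : a ord_max != 0.
Variables (N : nat) (psi : nat -> F) (v : 'I_n.+1 -> fps F) (G : fps F).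
Hypotheses (psi0 : psi 0 = 0)
  (vE : forall j i, fcoef (v j) i = iter j (twder D (N + i)) (psi i))
  (G_gen : fps_gen (fun c => exists P, c = iota P) v G)
  (psi_eq : forall k, diffop iota D a (N + k.+1) (psi k.+1) = fcoef G k).

Section Denominator.
Variable q : {poly K}.
Hypotheses (q_monic : q \is monic)
  (root_aq : forall s, root (a ord_max) s -> root q s)
  (sqfree_q : forall s, root q s -> q^`().[s] != 0).
Local Notation in_level := (in_level iota q).

Let q0 : q != 0. Proof. exact: monic_neq0. Qed.

(** One step of the recursion adds mu + e to the level, so lam >= mu + e propagates lam k to lam (k
    + 1). The indices up to [k0], where no uniform gain is known, are absorbed into [lam0] by the
    non-uniform statement [weak]. *)
Lemma solution_level (mu : nat) :
  (forall lam k,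
    (forall i j, (i <= k)%N -> in_level (lam * i + n) (fcoef (v j) i)) ->
    forall i, (i <= k)%N -> in_level (lam * i + mu) (fcoef G i)) ->
  exists2 lam, (mu <= lam)%N & forall k, in_level (lam * k) (psi k).
Proof.
move=> Glev; have [e [k0 ek0]] := diffop_solution_level DF an0 q0 root_aq sqfree_q.
have vlev lam k : (forall i, (i <= k)%N -> in_level (lam * i) (psi i)) ->
    forall i j, (i <= k)%N -> in_level (lam * i + n) (fcoef (v j) i).
  move=> psil i j ik; rewrite vE; apply: (in_level_twder DF) (psil _ ik) => //.
  by rewrite -ltnS.
have weak k : exists lam, forall i, (i <= k)%N -> in_level (lam * i) (psi i).
  elim: k => [|k [lam IH]].
    by exists 0%N => i; rewrite leqn0 => /eqP ->; rewrite psi0; exact: in_level0.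
  have := Glev _ _ (vlev _ _ IH) k (leqnn k); rewrite -psi_eq.
  move=> /ek0[[M psiM] _]; exists (maxn lam M) => i.
  rewrite leq_eqVlt => /orP[/eqP ->|ik].
    apply: in_level_le psiM => //; apply: leq_trans (leq_maxr lam M) _.
    by rewrite mulnS leq_addr.
  by apply: in_level_le (IH i ik) => //; rewrite leq_mul2r leq_maxl orbT.
have [lam0 lam0P] := weak k0.
pose lam := maxn lam0 (mu + e); exists lam.
  by rewrite /lam (leq_trans _ (leq_maxr _ _)) // leq_addr.
suff H k : forall i, (i <= k)%N -> in_level (lam * i) (psi i) by move=> k; exact: (H k).
elim: k => [|k IH] i.
  by rewrite leqn0 => /eqP ->; rewrite psi0; exact: in_level0.
rewrite leq_eqVlt => /orP[/eqP ->|ik]; last exact: IH.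
have [kk0|kk0] := leqP k.+1 k0.
  by apply: in_level_le (lam0P _ kk0) => //; rewrite leq_mul2r leq_maxl orbT.
have := Glev _ _ (vlev _ _ IH) k (leqnn k); rewrite -psi_eq => /ek0[_].
have -> : (k0 < N + k.+1)%N by apply: leq_trans kk0 _; exact: leq_addl.
move=> /(_ isT); apply: in_level_le => //.
by rewrite mulnS [(lam + _)%N]addnC -addnA leq_add2l leq_maxr.
Qed.

End Denominator.

Lemma solution_growth : exists (q : {poly K}) (lam : nat) (rho B : R),
  [/\ q \is monic, 1 <= rho, 0 < B, dominant nc rho q &
    forall k, exists P, [/\ psi k * iota q ^+ (lam * k) = iota P,
      (size P <= size q * (lam * k) + 1)%N & nrm nc rho P <= B ^+ k]].
Proof.
have [q [q_monic root_aq sqfree_q]] := squarefree_radical an0.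
have q0 : q != 0 by exact: monic_neq0.
have iq0 : iota q != 0 by rewrite (iota_eq0 DF).
have [mu [Glev Gnrm]] := fps_gen_level q0 Nc n G_gen.
have [lam mulam psil] := solution_level q_monic root_aq sqfree_q Glev.
have {}psil : forall k, exists P : {poly K},
    psi k * iota q ^+ (lam * k) = iota P /\ (size P <= size q * (lam * k) + 1)%N.
  by move=> k; have [P ? ?] := psil k; exists P.
have [P PP] := choice psil.
have [rho [c [C [k1 [rho1 c0 dq est]]]]] := nrm_diffop_lower Nc lam q_monic an0.
have rho0 : 0 < rho by exact: lt_le_trans rho1.
have nge0 := nrm_ge0 Nc rho1.
(* The factor q^(n-j) puts all derivatives over the common denominator q^(lam i + n) that
   [fps_gen_level] expects. *)
pose V (j : 'I_n.+1) i := q ^+ (n - j) * twder_num q (lam * i) (N + i) (P i) j.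
have vV i (j : 'I_n.+1) : fcoef (v j) i * iota q ^+ (lam * i + n) = iota (V j i).
  have jn : (j <= n)%N by rewrite -ltnS.
  have [PE _] := PP i; rewrite vE /V rmorphM -(twder_numP DF _ _ PE) rmorphXn.
  have -> : iota q ^+ (lam * i + n) = iota q ^+ (n - j) * iota q ^+ (lam * i + j).
    by rewrite -exprD addnCA subnK.
  by rewrite mulrCA.
have V0 j : V j 0%N = 0.
  apply: (frac_deriv_inj DF); rewrite -vV rmorph0 vE psi0.
  by rewrite (iter_twder0 DF) mul0r.
have [CG CG0 CGP] := Gnrm lam rho rho1.
pose E := \sum_(j < n.+1) nrm nc rho (q ^+ (n - j)).
have E0 : 0 <= E by apply: sumr_ge0.
have EP (j : 'I_n.+1) : nrm nc rho (q ^+ (n - j)) <= E.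
  by rewrite /E (bigD1 j) //= lerDl sumr_ge0.
(* The exponent is the gap between the denominators q^(lam (k+1) + n) of the operator and q^(lam k +
   mu) of G. The powers k^n of the lower bound [c] and of the upper bound [C] have cancelled. *)
pose C1 := E * (Num.max 0 C / c) * nrm nc rho (q ^+ (lam + n - mu)).
have C10 : 0 <= C1.
  by rewrite /C1 mulr_ge0 // mulr_ge0 // divr_ge0 ?(ltW c0) // le_max lexx.
have big k W : (k1 < k.+1)%N -> fcoef G k * iota q ^+ (lam * k + mu) = iota W ->
    forall j, nrm nc rho (V j k.+1) <= C1 * nrm nc rho W.
  move=> k1k GW j.
  have jn : (j <= n)%N by rewrite -ltnS.
  have [PE sP] := PP k.+1.
  have kN : (k1 < N + k.+1)%N by apply: leq_trans k1k _; exact: leq_addl.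
  have lk : (lam * k.+1 <= lam * (N + k.+1))%N by rewrite leq_mul2l leq_addl orbT.
  have [low up] := est _ _ _ kN lk sP.
  have dE : diffop_num q a (lam * k.+1) (N + k.+1) (P k.+1) = W * q ^+ (lam + n - mu).
    apply: (frac_deriv_inj DF); rewrite -(diffop_numP DF q0 a _ PE) psi_eq.
    rewrite rmorphM rmorphXn -GW -mulrA -exprD; congr (_ * _ ^+ _).
    rewrite -addnA subnKC; first by rewrite mulnS -addnA addnCA.
    by rewrite (leq_trans mulam) ?leq_addr.
  apply: le_trans (nrmM Nc rho1 _ _) _; rewrite /C1 -!mulrA.
  apply: ler_pM => //.
  apply: le_trans (up _ jn) _; rewrite -mulrA.
  set Y := _ ^+ n * _ in low *.
  have Y0 : 0 <= Y by rewrite mulr_ge0 // exprn_ge0.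
  apply: le_trans (_ : _ <= Num.max 0 C * Y) _.
    by rewrite ler_wpM2r // le_max lexx orbT.
  rewrite ler_wpM2l ?le_max ?lexx // ler_pdivlMl // mulrA.
  apply: le_trans low _; rewrite dE; apply: le_trans (nrmM Nc rho1 _ _) _.
  by rewrite mulrC.
pose t i := \sum_(j < n.+1) nrm nc rho (V j i.+1).
have t0 i : 0 <= t i by apply: sumr_ge0.
pose T := \sum_(i < k1) t i.
have T0 : 0 <= T by apply: sumr_ge0.
(* [T] sums the finitely many terms to which the a priori estimate does not apply. The shift from
   G_k to psi_(k+1) yields one factor X, and X = 1 / Z makes X (T + C1 CG) <= 1, which closes the
   induction in [main]. *)
pose Z := 1 + T + C1 * CG.
have Z1 : 1 <= Z by rewrite /Z -addrA lerDl addr_ge0 // mulr_ge0.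
have Z0 : 0 < Z by exact: lt_le_trans Z1.
pose X := Z^-1.
have X0 : 0 < X by rewrite invr_gt0.
have X1 : X <= 1 by rewrite invf_le1.
have Xi i : X ^+ i <= 1 by rewrite exprn_ile1 // ltW.
have Xi0 i : 0 <= X ^+ i by rewrite exprn_ge0 // ltW.
have main k : forall j, \sum_(i < k.+1) nrm nc rho (V j i) * X ^+ i <= 1.
  elim: k => [|k IH] j.
    by rewrite big_ord1 V0 nrm0 mul0r.
  have X01 : 0 <= X <= 1 by rewrite X1 ltW.
  have [W GW sW] := CGP X k V X01 (fun i j _ => vV i j) IH.
  rewrite big_ord_recl /= V0 nrm0 mul0r add0r.
  apply: le_trans (_ : _ <= X * (T + C1 * CG)) _; last first.
    by rewrite /X ler_pdivrMl // mulr1 /Z -addrA lerDr.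
  apply: le_trans (_ : _ <= X * (\sum_(i < k.+1) (if (i < k1)%N then t i else 0)
     + C1 * \sum_(i < k.+1) nrm nc rho (W i) * X ^+ i)) _; last first.
    rewrite ler_wpM2l ?(ltW X0) // lerD ?ler_wpM2l //.
    exact: sum_indicator_le.
  rewrite mulr_sumr -big_split mulr_sumr; apply: ler_sum => i _ /=.
  rewrite /bump /= add1n exprS mulrCA ler_wpM2l ?(ltW X0) //.
  case: ltnP => ik1.
    apply: le_trans (_ : _ <= t i + 0) _; last first.
      by rewrite lerD2l; apply: mulr_ge0 => //; apply: mulr_ge0.
    rewrite addr0; apply: le_trans (_ : _ <= nrm nc rho (V j i.+1)) _.
      by rewrite ler_piMr.
    by rewrite /t (bigD1 j) //= lerDl sumr_ge0.
  rewrite add0r mulrA ler_wpM2r //; apply: big; first by rewrite ltnS.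
  by apply: GW; rewrite -ltnS.
(* [main] bounds [V ord0 k], which is q^n P_k; removing q^n costs at most 2^n because [q] is monic
   and dominant at [rho >= 1]. *)
exists q, lam, rho, (2 ^+ n / X); split=> //.
  by rewrite divr_gt0 // exprn_gt0.
move=> k; have [PE sP] := PP k; exists (P k); split=> //.
case: k => [|k] in PE sP *.
  suff -> : P 0%N = 0 by rewrite nrm0 expr0.
  by apply: (frac_deriv_inj DF); rewrite -PE psi0 mul0r rmorph0.
have r1 : 1 <= rho ^+ (size q).-1 by rewrite exprn_ege1.
have qP m Q : nrm nc rho Q <= 2 ^+ m * nrm nc rho (q ^+ m * Q).
  elim: m Q => [|m IH] Q; first by rewrite !expr0 !mul1r.
  have [_ dql _] := dq; apply: le_trans (IH _) _.
  rewrite exprSr -mulrA ler_wpM2l ?exprn_ge0 // exprS -mulrA.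
  have := dql (q ^+ m * Q); rewrite (monicP q_monic) (absv1 Nc) mul1r.
  have := ler_wpM2r (nge0 (q ^+ m * Q)) r1; rewrite mul1r.
  rewrite mulrAC; move: (nrm _ _ _) => y; move: (_ ^+ _ * y) => w; lra.
have := main k.+1 ord0; rewrite big_ord_recr /=.
rewrite /V /= subn0 => h.
have {}h : nrm nc rho (q ^+ n * P k.+1) * X ^+ k.+1 <= 1.
  by apply: le_trans h; rewrite lerDr sumr_ge0 // => i _; rewrite mulr_ge0.
apply: le_trans (qP n _) _; rewrite expr_div_n.
have h2 : nrm nc rho (q ^+ n * P k.+1) <= (X ^+ k.+1)^-1.
  by rewrite -[leRHS]mul1r ler_pdivlMr // exprn_gt0.
apply: ler_pM => //.
by rewrite -exprM; apply: ler_weXn2l; [rewrite ler1n | rewrite leq_pmulr].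
Qed.

End Convergence.

(** * Taylor expansion and linearisation *)

Section MpolyTaylor.
Variables (n : nat) (C A : comNzRingType) (f : {rmorphism C -> A}).

Lemma mpoly_gen_ind (P : mpoly.mpoly n C -> Prop) :
  (forall c, P (mpoly.mpolyC n c)) -> (forall i, P (mpoly.mpolyX C (mpoly.mnm1 i))) ->
  (forall p q, P p -> P q -> P (p + q)) -> (forall p q, P p -> P q -> P (p * q)) ->
  forall p, P p.
Proof.
move=> PC PX PD PM p; have P1 : P 1 by rewrite -mpoly.mpolyC1; exact: PC.
elim/mpoly.mpolyind: p => [|c m p _ _ IH]; first by rewrite -mpoly.mpolyC0; exact: PC.
apply: PD => //; rewrite -mpoly.mul_mpolyC; apply: (PM); first exact: PC.
rewrite mpoly.mpolyXE_id; apply: (big_ind P); [exact: P1 | exact: PM | move=> i _].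
by elim: (mpoly.fun_of_multinom _ _) => [|k IHk]; rewrite ?expr0 // exprS; apply: (PM).
Qed.

Variables (S : A -> Prop).
Hypotheses (SC : forall c, S (f c)) (SD : forall x y, S x -> S y -> S (x + y))
  (SM : forall x y, S x -> S y -> S (x * y)).

Lemma mmap_closed (h : 'I_n -> A) (p : mpoly.mpoly n C) : (forall i, S (h i)) -> S (mpoly.mmap f h p).
Proof.
move=> Sh; elim/mpoly_gen_ind: p => [c|i|p q Sp Sq|p q Sp Sq].
- by rewrite mpoly.mmapC; exact: SC.
- by rewrite mpoly.mmapX mpoly.mmap1U; exact: Sh.
- by rewrite rmorphD; exact: SD.
- by rewrite rmorphM; exact: SM.
Qed.

(** The remainder is tracked inside a set closed under the ring operations, so that it will be known
    to be a polynomial expression in the tails. Induction on sums and products replaces any formula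
    with higher derivatives. *)
Lemma mpoly_taylor (u w : 'I_n -> A) z (p : mpoly.mpoly n C) :
  (forall i, S (u i)) -> (forall i, S (w i)) -> S z ->
  exists2 E, S E &
    mpoly.mmap f (fun i => u i + z * w i) p = mpoly.mmap f u p
      + z * (\sum_i mpoly.mmap f u (mpoly.mderiv i p) * w i) + z ^+ 2 * E.
Proof.
move=> Su Sw Sz; have S0 : S 0 by rewrite -(rmorph0 f).
have S_sum (g : 'I_n -> A) : (forall i, S (g i)) -> S (\sum_i g i).
  by move=> Sg; apply: big_ind.
elim/mpoly_gen_ind: p => [c|i|p q [E SE pE] [E' SE' qE]|p q [E SE pE] [E' SE' qE]].
- exists 0 => //; rewrite !mpoly.mmapC big1 ?mulr0 ?addr0 // => i _.
  by rewrite mpoly.mderivC rmorph0 mul0r.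
- exists 0 => //; rewrite !mpoly.mmapX !mpoly.mmap1U mulr0 addr0.
  rewrite (bigD1 i) //= big1 ?addr0 => [|j ji].
    rewrite mpoly.mderivX mpoly.mnm1E eqxx scale1r -{1}[mpoly.mnm1 i]mpoly.add0m mpoly.addmK mpoly.mpolyX0.
    by rewrite rmorph1 mul1r.
  by rewrite mpoly.mderivX mpoly.mnm1E eq_sym (negPf ji) scale0r rmorph0 mul0r.
- exists (E + E'); first exact: SD.
  rewrite !rmorphD /= pE qE.
  under [X in _ = _ + z * X + _]eq_bigr do rewrite mpoly.mderivD rmorphD mulrDl.
  rewrite big_split /=; ring.
- set p' := \sum_i _ in pE; set q' := \sum_i _ in qE.
  have Sp' : S p' by apply: S_sum => i; apply: SM => //; exact: mmap_closed.
  have Sq' : S q' by apply: S_sum => i; apply: SM => //; exact: mmap_closed.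
  have Sp := mmap_closed p Su; have Sq := mmap_closed q Su.
  exists (p' * q' + E * mpoly.mmap f u q + mpoly.mmap f u p * E'
    + z * (p' * E' + E * q') + z * (z * (E * E'))).
    by do ![apply: SD | apply: SM].
  rewrite !rmorphM /= pE qE.
  have -> : \sum_i mpoly.mmap f u (mpoly.mderiv i (p * q)) * w i
      = p' * mpoly.mmap f u q + mpoly.mmap f u p * q'.
    rewrite /p' /q' mulr_suml mulr_sumr -big_split /=; apply: eq_bigr => i _.
    rewrite mpoly.mderivM rmorphD !rmorphM /=; ring.
  ring.
Qed.

End MpolyTaylor.

Section FpsShift.
Variable A : comNzRingType.
Implicit Types f g : fps A.

Definition fps_shift m f : fps A := Fps (fun k => fcoef f (m + k)).
Definition fps_trunc N f : fps A := Fps (fun k => if (k <= N)%N then fcoef f k else 0).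
(** Degree N already belongs to [fps_trunc], hence the 0 at index 0: the tail is divisible by x,
    which provides the start psi_0 = 0 of the recursion. *)
Definition fps_tail N f : fps A :=
  Fps (fun k => if k == 0%N then 0 else fcoef f (N + k)).

Lemma fcoefXnM N f k :
  fcoef (fpsX A ^+ N * f) k = if (k < N)%N then 0 else fcoef f (k - N).
Proof.
elim: N k => [|N IH] k; first by rewrite mul1r subn0.
rewrite exprS -mulrA; case: k => [|k]; last by rewrite fcoefXM IH ltnS subSS.
by rewrite fcoefM big_ord1 /= mul0r.
Qed.

Lemma fps_trunc_tail N f : f = fps_trunc N f + fpsX A ^+ N * fps_tail N f.
Proof.
apply: fpsP => k; rewrite fcoefD fcoefXnM /=.
case: ltngtP => [kN|Nk|->]; rewrite ?addr0 //.
  by rewrite add0r subn_eq0 leqNgt Nk /= subnKC // ltnW.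
by rewrite subnn eqxx addr0.
Qed.

Lemma fps_shiftE N f : (forall k, (k < N)%N -> fcoef f k = 0) ->
  f = fpsX A ^+ N * fps_shift N f.
Proof.
move=> f0; apply: fpsP => k; rewrite fcoefXnM /=.
by case: ltnP => [/f0|Nk] //; rewrite subnKC.
Qed.

Definition fps_finite f := exists N, forall k, (N <= k)%N -> fcoef f k = 0.

Lemma fps_finiteC c : fps_finite (fpsC c).
Proof. by exists 1%N => -[]. Qed.

Lemma fps_finiteD f g : fps_finite f -> fps_finite g -> fps_finite (f + g).
Proof.
move=> [N fN] [M gM]; exists (maxn N M) => k; rewrite geq_max => /andP[Nk Mk].
by rewrite fcoefD fN // gM // addr0.
Qed.

Lemma fps_finiteM f g : fps_finite f -> fps_finite g -> fps_finite (f * g).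
Proof.
move=> [N fN] [M gM]; exists (N + M)%N => k NMk.
rewrite fcoefM big1 // => i _; have [Ni|iN] := leqP N i; first by rewrite fN ?mul0r.
by rewrite gM ?mulr0 //; move: (ltn_ord i) NMk iN; lia.
Qed.

Lemma fps_finite_shift m f : fps_finite f -> fps_finite (fps_shift m f).
Proof. by move=> [N fN]; exists N => k Nk /=; rewrite fN // (leq_trans Nk) // leq_addl. Qed.

Variables (n : nat) (v : 'I_n -> fps A).
Local Notation gen := (fps_gen (fun=> True) v).

Lemma fps_gen_finite f : fps_finite f -> gen f.
Proof.
move=> [N]; elim: N f => [|N IH] f fN.
  have -> : f = fpsC 0 by apply: fpsP => k; rewrite fN //= if_same.
  exact: fps_gen_const.
have -> : f = fpsC (fcoef f 0) + fpsX A * fps_shift 1 f.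
  by apply: fpsP => -[|k]; rewrite fcoefD ?fcoefXM ?add0r // fcoefM big_ord1 /= mul0r addr0.
apply: fps_gen_add; first exact: fps_gen_const.
apply: fps_gen_mul; first exact: fps_genX.
by apply: IH => k Nk /=; rewrite fN.
Qed.

Lemma fps_gen_sum m (g : 'I_m -> fps A) : (forall i, gen (g i)) -> gen (\sum_i g i).
Proof.
move=> gg; apply: (big_ind gen) => //; last exact: fps_gen_add.
have -> : 0 = fpsC 0 :> fps A by [].
exact: fps_gen_const.
Qed.

Lemma fps_genXn N : gen (fpsX A ^+ N).
Proof.
elim: N => [|N IH]; last by rewrite exprS; apply: fps_gen_mul => //; exact: fps_genX.
have -> : fpsX A ^+ 0 = fpsC 1 by [].
exact: fps_gen_const.
Qed.

End FpsShift.

Lemma fcoefXnM_add (A : comNzRingType) N (f : fps A) k :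
  fcoef (fpsX A ^+ N * f) (N + k) = fcoef f k.
Proof. by rewrite fcoefXnM ltnNge leq_addr addKn. Qed.

Section Linearisation.
Variables (K F : fieldType) (iota : {rmorphism {poly K} -> F}) (D : F -> F).

Definition fps_const (c : K) : fps F := fpsC (iota c%:P).

Lemma fps_const_is_zmod_morphism : zmod_morphism fps_const.
Proof.
move=> x y; apply: fpsP => k; rewrite fcoefD /fps_const polyCB rmorphB /=.
by case: eqP => // _; rewrite oppr0 addr0.
Qed.

Lemma fps_const_is_monoid_morphism : monoid_morphism fps_const.
Proof.
split=> [|x y]; first by rewrite /fps_const polyC1 rmorph1.
apply: fpsP => k; rewrite fcoefCM /fps_const polyCM rmorphM /=.
by case: eqP; rewrite ?mulr0.
Qed.

HB.instance Definition _ :=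
  GRing.isZmodMorphism.Build K (fps F) fps_const fps_const_is_zmod_morphism.
HB.instance Definition _ :=
  GRing.isMonoidMorphism.Build K (fps F) fps_const fps_const_is_monoid_morphism.

Definition fps_delta (phi : fps F) : fps F :=
  Fps (fun k => k%:R * fcoef phi k + D (fcoef phi k)).

Lemma fcoef_iter_delta phi j k :
  fcoef (iter j fps_delta phi) k = iter j (twder D k) (fcoef phi k).
Proof. by elim: j => //= j ->. Qed.

Definition fps_jet n (phi : fps F) (i : 'I_n.+2) : fps F :=
  if val i is j.+1 then iter j fps_delta phi else fpsX F.

(** Abstract counterpart of [pl_subst], convertible to it when [iota] is [tofrac] and [D] is
    [ratderiv]. *)
Definition fps_subst n (P : mpoly.mpoly n.+2 K) (phi : fps F) : fps F :=
  mpoly.mmap fps_const (fps_jet phi) P.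

Hypothesis DF : frac_deriv iota D.
Variables (n : nat) (P : mpoly.mpoly n.+2 K) (phi : fps F) (m N : nat).
Local Notation dP j := (mpoly.mderiv (lift ord0 j) P).
Hypotheses (P_phi : fps_subst P phi = 0) (mN : (m < N)%N)
  (dP_ge_m : forall (j : 'I_n.+1) k, (k < m)%N -> fcoef (fps_subst (dP j) phi) k = 0).

Let u (i : 'I_n.+2) := fps_trunc N (fps_jet phi i).
Let w (i : 'I_n.+2) := fps_tail N (fps_jet phi i).
Let v (j : 'I_n.+1) := w (lift ord0 j).

Lemma tail_jet j i : fcoef (v j) i =
  iter j (twder D (N + i)) (if i == 0%N then 0 else fcoef phi (N + i)).
Proof.
rewrite /v /w /fps_jet /= /bump /=.
case: eqP => _; first by rewrite (iter_twder0 DF).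
by rewrite fcoef_iter_delta.
Qed.

Lemma tail_jet0 : w ord0 = fpsC 0.
Proof.
apply: fpsP => k /=; rewrite if_same; case: eqP => // /eqP k0.
by case: eqP => // Nk; move: mN k0 Nk; lia.
Qed.

Lemma fps_finite_u i : fps_finite (u i).
Proof. by exists N.+1 => k Nk /=; rewrite leqNgt Nk. Qed.

Lemma fps_finite_subst_u Q : fps_finite (mpoly.mmap fps_const u Q).
Proof.
apply: (@mmap_closed _ _ _ fps_const (@fps_finite F)).
- by move=> c; exact: fps_finiteC.
- exact: fps_finiteD.
- exact: fps_finiteM.
exact: fps_finite_u.
Qed.

Lemma jet_taylor Q : exists2 E, fps_gen (fun=> True) v E &
  fps_subst Q phi = mpoly.mmap fps_const u Q
    + fpsX F ^+ N * (\sum_j mpoly.mmap fps_const u (mpoly.mderiv (lift ord0 j) Q) * v j)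
    + fpsX F ^+ (2 * N) * E.
Proof.
have gC c : fps_gen (fun=> True) v (fps_const c) by exact: fps_gen_const.
have gu i : fps_gen (fun=> True) v (u i) by apply: fps_gen_finite; exact: fps_finite_u.
have gw i : fps_gen (fun=> True) v (w i).
  have [->|i0] := eqVneq i ord0; first by rewrite tail_jet0; exact: fps_gen_const.
  have [j ->] : exists j, i = lift ord0 j.
    by case: (unliftP ord0 i) i0 => [j ->|->] //; exists j.
  exact: fps_gen_var.
have [E gE EE] := mpoly_taylor gC (@fps_gen_add _ _ _ v) (@fps_gen_mul _ _ _ v) Q gu gw
  (fps_genXn v N).
exists E => //; rewrite mulnC exprM.
have -> : fps_subst Q phi = mpoly.mmap fps_const (fun i => u i + fpsX F ^+ N * w i) Q.
  rewrite /fps_subst /mpoly.mmap; apply: eq_bigr => mm _; congr (_ * _).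
  by apply: eq_bigr => i _; congr (_ ^+ _); exact: fps_trunc_tail.
rewrite EE big_ord_recl tail_jet0.
have -> : fpsC 0 = 0 :> fps F by [].
by rewrite mulr0 add0r.
Qed.

(** Compare the coefficients of x^(N+m+k+1) in Taylor's formula. Writing dP_j at the truncation as
    x^m (a_j + x W_j), everything except the a_j carries an extra factor x, so the right-hand side
    at index k involves the tails up to index k only. *)
Lemma linearisation : exists2 G, fps_gen (fun=> True) v G &
  forall k, \sum_j fcoef (fps_subst (dP j) phi) m * fcoef (v j) k.+1 = fcoef G k.
Proof.
have [E gE] := jet_taylor P; rewrite P_phi => PE.
pose A j := fps_shift m (mpoly.mmap fps_const u (dP j)).
(* Taylor's formula applied to the derivative itself: below degree N it does not feel the
   truncation, and the a_j sit at degree m < N. *)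
have coef_u j k : (k < N)%N ->
    fcoef (mpoly.mmap fps_const u (dP j)) k = fcoef (fps_subst (dP j) phi) k.
  move=> kN; have [E' _ ->] := jet_taylor (dP j).
  rewrite !fcoefD !fcoefXnM kN mul2n -addnn (leq_trans kN (leq_addr _ _)).
  by rewrite !addr0.
have AE j : mpoly.mmap fps_const u (dP j) = fpsX F ^+ m * A j.
  apply: fps_shiftE => k km; rewrite coef_u ?dP_ge_m //.
  exact: ltn_trans mN.
pose W j := fps_shift 1 (A j).
have AW j : A j = fpsC (fcoef (fps_subst (dP j) phi) m) + fpsX F * W j.
  apply: fpsP => -[|k]; rewrite fcoefD.
    by rewrite fcoefM big_ord1 /= mul0r addr0 addn0 coef_u.
  by rewrite fcoefXM /= add0r.
pose H := fps_shift (N + m).+1 (mpoly.mmap fps_const u P).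
pose G := fpsC (-1) * (H + (\sum_j W j * v j) + fpsX F ^+ (N - m.+1) * E).
exists G.
  apply: fps_gen_mul; first exact: fps_gen_const.
  apply: fps_gen_add; last by apply: fps_gen_mul => //; exact: fps_genXn.
  apply: fps_gen_add.
    by apply: fps_gen_finite; apply: fps_finite_shift; exact: fps_finite_subst_u.
  apply: fps_gen_sum => j; apply: fps_gen_mul; last exact: fps_gen_var.
  apply: fps_gen_finite; do 2!apply: fps_finite_shift; exact: fps_finite_subst_u.
move=> k; rewrite /G fcoefCM !fcoefD mulN1r.
apply/eqP; rewrite -subr_eq0 opprK; apply/eqP.
have := congr1 (fun f => fcoef f (N + m + k.+1)) PE.
have -> : fpsX F ^+ N * (\sum_j mpoly.mmap fps_const u (dP j) * v j) =
   fpsX F ^+ (N + m) * (\sum_j A j * v j).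
  rewrite exprD -mulrA mulr_sumr; congr (_ * _); apply: eq_bigr => j _.
  by rewrite AE mulrA.
have -> : fpsX F ^+ (2 * N) * E = fpsX F ^+ (N + m) * (fpsX F * (fpsX F ^+ (N - m.+1) * E)).
  rewrite !mulrA -exprSr -exprD; congr (_ ^+ _ * _); lia.
have -> : \sum_j A j * v j = \sum_j fpsC (fcoef (fps_subst (dP j) phi) m) * v j
    + fpsX F * \sum_j W j * v j.
  rewrite mulr_sumr -big_split; apply: eq_bigr => j _ /=.
  by rewrite AW mulrDl mulrA.
rewrite !fcoefD !fcoefXnM_add fcoefD !fcoefXM.
have -> : fcoef (\sum_j fpsC (fcoef (fps_subst (dP j) phi) m) * v j) k.+1 =
    \sum_j fcoef (fps_subst (dP j) phi) m * fcoef (v j) k.+1.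
  rewrite (big_morph (fun f => fcoef f k.+1) (id1 := 0) (op1 := +%R)) //.
  by apply: eq_bigr => j _; rewrite fcoefCM.
rewrite /H [fcoef (fps_shift _ _) k]/= addSnnS => /esym eq0.
apply: etrans (etrans eq0 _); last by rewrite /= if_same.
ring.
Qed.

End Linearisation.

(** * Coefficient bounds for a formal solution *)

Section FormalGrowth.
Variables (K : numClosedFieldType) (F : fieldType).
Variables (iota : {rmorphism {poly K} -> F}) (D : F -> F).
Hypothesis DF : frac_deriv iota D.
Variables (R : archiRealFieldType) (nc : K -> R).
Hypothesis Nc : abs_value nc.
Variables (n : nat) (P : mpoly.mpoly n.+2 K) (phi : fps F) (m : nat).
Hypotheses (P_phi : fps_subst iota D P phi = 0)
  (dP_ge_m : forall (j : 'I_n.+1) k, (k < m)%N ->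
     fcoef (fps_subst iota D (mpoly.mderiv (lift ord0 j) P) phi) k = 0)
  (dP_n_m : fcoef (fps_subst iota D (mpoly.mderiv (lift ord0 ord_max) P) phi) m != 0).

Lemma formal_solution_growth : exists (q : {poly K}) (lam : nat) (rho B : R),
  [/\ q \is monic, 1 <= rho, 0 < B, dominant nc rho q &
    forall k, exists Q, [/\ fcoef phi (m.+1 + k.+1) * iota q ^+ (lam * k.+1) = iota Q,
      (size Q <= size q * (lam * k.+1) + 1)%N & nrm nc rho Q <= B ^+ k.+1]].
Proof.
have [G gG GE] := linearisation P_phi (ltnSn m) dP_ge_m.
pose al := fun j : 'I_n.+1 => fcoef (fps_subst iota D (mpoly.mderiv (lift ord0 j) P) phi) m.
pose v := fun j : 'I_n.+1 => fps_tail m.+1 (fps_jet D phi (lift ord0 j)).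
have {}GE k : \sum_j al j * fcoef (v j) k.+1 = fcoef G k by exact: GE.
have [d d0 gdG] := fps_gen_clear DF gG.
have alE j : exists q, exists2 p, q != 0 & iota q * al j = iota p.
  have [p [q [q0 ->]]] := frac_deriv_repr DF (al j); exists q, p => //.
  by rewrite mulrC divfK // (iota_eq0 DF).
have [q {}alE] := choice alE.
pose d' := \prod_j q j.
have q0 j : q j != 0 by have [p] := alE j.
have d'0 : d' != 0 by apply/prodf_neq0 => j _.
have d'al j : exists p, iota d' * al j = iota p.
  have [p _ pE] := alE j; exists ((\prod_(i | i != j) q i) * p).
  by rewrite /d' (bigD1 j) //= !rmorphM -pE; ring.
have [p pE] := choice d'al.
pose a j := d * p j.
have aE j : iota (a j) = iota (d * d') * al j by rewrite /a !rmorphM -pE mulrA.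
have an0 : a ord_max != 0.
  by rewrite -(iota_eq0 DF) aE mulf_neq0 // (iota_eq0 DF) mulf_neq0.
pose psi k := if k == 0%N then 0 else fcoef phi (m.+1 + k).
have vE j i : fcoef (v j) i = iter j (twder D (m.+1 + i)) (psi i).
  exact: (tail_jet DF).
have gG' : fps_gen (fun c => exists P, c = iota P) v
    (fpsC (iota d') * (fpsC (iota d) * G)).
  by apply: fps_gen_mul => //; apply: fps_gen_const; exists d'.
have psi_eq k : diffop iota D a (m.+1 + k.+1) (psi k.+1) =
    fcoef (fpsC (iota d') * (fpsC (iota d) * G)) k.
  rewrite !fcoefCM -GE !mulr_sumr; apply: eq_bigr => j _.
  by rewrite -vE aE rmorphM; ring.
have [r [lam [rho [B [r_monic rho1 B0 dr H]]]]] :=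
  solution_growth DF Nc an0 (erefl : psi 0%N = 0) vE gG' psi_eq.
by exists r, lam, rho, B; split=> // k; exact: (H k.+1).
Qed.

(** For |t| >= rho, [nrm_scale] gives |Q(t)| at most |t|^(size q lam (k+1)) B^(k+1), while |q(t)| >=
    1/2 by dominance of the monic [q]. This explains d = size q lam and A = B 2^lam. *)
Lemma formal_solution_bound : exists (q : {poly K}) (lam d : nat) (T A : R),
  [/\ 1 <= T, 0 < A & forall k, exists Q,
    fcoef phi (m.+1 + k.+1) * iota (q ^+ (lam * k.+1)) = iota Q /\
    forall t, T <= nc t -> (q ^+ (lam * k.+1)).[t] != 0 /\
      nc (Q.[t] / (q ^+ (lam * k.+1)).[t]) <= (A * nc t ^+ d) ^+ k.+1].
Proof.
have [q [lam [rho [B [q_monic rho1 B0 dq H]]]]] := formal_solution_growth.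
exists q, lam, (size q * lam)%N, rho, (B * 2 ^+ lam); split=> //.
  by rewrite mulr_gt0 // exprn_gt0.
move=> k; have [Q [QE sQ nQ]] := H k; exists Q; rewrite rmorphXn; split=> // t rt.
have [_ _ /(_ t rt)] := dq; rewrite (monicP q_monic) (absv1 Nc) mul1r => qt.
have rho0 : 0 < rho by exact: lt_le_trans rho1.
have t1 : 1 <= nc t by exact: le_trans rt.
have te : 1 <= nc t ^+ (size q).-1 by exact: exprn_ege1.
have qt2 : 2^-1 <= nc q.[t] by apply: le_trans qt; rewrite ler_peMl // invr_ge0.
have qt0 : q.[t] != 0.
  by apply: contraTneq qt2 => ->; rewrite (absv0 Nc) -ltNge invr_gt0.
rewrite horner_exp expf_neq0 //; split=> //.
set M := (lam * k.+1)%N in sQ *.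
have -> : Q.[t] / q.[t] ^+ M = Q.[t] * (q.[t]^-1) ^+ M by rewrite exprVn.
rewrite (absvM Nc) (absvX Nc).
have qV : nc (q.[t]^-1) <= 2.
  have e1 : nc (q.[t]^-1) * nc q.[t] = 1 by rewrite -(absvM Nc) mulVf // (absv1 Nc).
  have := ler_wpM2l (absv_ge0 Nc (q.[t]^-1)) qt2; rewrite e1; lra.
have hQ : nc Q.[t] <= nc t ^+ (size q * M) * B ^+ k.+1.
  apply: le_trans (absv_horner Nc _ _) _.
  apply: le_trans (nrm_scale Nc rho1 rt (N := (size q * M)%N) _) _; first by rewrite -addn1.
  have tr0 : 0 <= nc t / rho by rewrite divr_ge0 ?(absv_ge0 Nc) // ltW.
  apply: ler_pM => //; [exact: exprn_ge0 | exact: nrm_ge0 |].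
  apply: lerXn2r; rewrite ?nnegrE ?(absv_ge0 Nc) //.
  by rewrite ler_pdivrMr // ler_peMr // (absv_ge0 Nc).
have -> : (B * 2 ^+ lam * nc t ^+ (size q * lam)) ^+ k.+1 =
   nc t ^+ (size q * M) * B ^+ k.+1 * 2 ^+ M.
  by rewrite !exprMn -!exprM mulnA; ring.
apply: ler_pM => //; rewrite ?(absv_ge0 Nc) ?exprn_ge0 ?(absv_ge0 Nc) //.
by apply: lerXn2r; rewrite ?nnegrE ?(absv_ge0 Nc).
Qed.

End FormalGrowth.

(** * Specialisation to complex rational functions and the modulus *)

Lemma frac_deriv_tofrac (K : fieldType) :
  frac_deriv (@tofrac {poly K}) (@ratderiv K).
Proof.
split.
- by move=> p q /eqP; rewrite tofrac_eq => /eqP.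
- by move=> u; exists (ratnum u), (ratden u); split; [exact: ratden_neq0 | exact: ratE].
- exact: ratderiv_frac.
Qed.

Lemma abs_value_normc (R : realType) : abs_value (@ComplexField.Normc.normc R).
Proof.
split.
- by case=> x y; exact: sqrtr_ge0.
- exact: ComplexField.Normc.eq0_normc.
- exact: ComplexField.Normc.normcM.
- exact: le_normcD.
- exact: normcN.
- by move=> k; rewrite normcMn ComplexField.Normc.normc1.
Qed.

Lemma powlog_growth (R : realType) (n : nat) (P : mpoly.mpoly n.+2 R[i])
    (phi : powlog R) (m : nat) :
  pl_subst P phi = 0 ->
  (forall (j : 'I_n.+1) (k : nat), (k < m)%N ->
     fcoef (pl_subst (dFdy j P) phi) k = 0) ->
  fcoef (pl_subst (dFdy ord_max P) phi) m != 0 ->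
  exists (d : nat) (T A : R), [/\ 1 <= T, 0 < A &
    forall k (t : R[i]), T <= ComplexField.Normc.normc t ->
      ~~ ratpole (fcoef phi (m.+1 + k.+1)) t /\
      ComplexField.Normc.normc (rateval (fcoef phi (m.+1 + k.+1)) t)
        <= (A * ComplexField.Normc.normc t ^+ d) ^+ k.+1].
Proof.
move=> P_phi dPm dPn.
have DF := frac_deriv_tofrac R[i]; have Nc := abs_value_normc R.
have [q [lam [d [T [A [T1 A0 H]]]]]] := formal_solution_bound DF Nc P_phi dPm dPn.
exists d, T, A; split=> // k t Tt; have [Q [QE /(_ t Tt)[qt bound]]] := H k.
have [npole valE] := rateval_frac Q qt.
have qM0 : q ^+ (lam * k.+1) != 0 by apply: contraNneq qt => ->; rewrite horner0.
have phiE : fcoef phi (m.+1 + k.+1) = tofrac Q / tofrac (q ^+ (lam * k.+1)).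
  have qMF : tofrac (q ^+ (lam * k.+1)) != 0 by rewrite tofrac_eq0.
  by rewrite -QE mulfK.
by rewrite phiE valE.
Qed.

(** * Uniform convergence in a sector *)

(** With r_N = 2 M / 2^N the intervals of centre s_N and radius r_N are nested, as r_N = r_(N+1) + M
    / 2^N; the limit is the supremum of their lower ends. *)
Lemma geometric_limit (R : realType) (u : nat -> R) (M : R) N0 :
  (forall k, (N0 <= k)%N -> `|u k| <= M / 2 ^+ k) ->
  exists l, forall N, (N0 <= N)%N -> `|\sum_(k < N) u k - l| <= 2 * M / 2 ^+ N.
Proof.
move=> uM; pose s N := \sum_(k < N) u k; pose r N := 2 * M / 2 ^+ N.
have rS N : r N = r N.+1 + M / 2 ^+ N.
  by rewrite /r exprS; field; rewrite expf_neq0.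
have bnd N j : (N0 <= N)%N -> s N - r N <= s (N + j)%N - r (N + j)%N /\
    s (N + j)%N + r (N + j)%N <= s N + r N.
  move=> N0N; elim: j => [|j [IH1 IH2]]; first by rewrite addn0.
  have sS : s (N + j.+1)%N = s (N + j)%N + u (N + j)%N.
    by rewrite addnS /s big_ord_recr.
  have := uM (N + j)%N (leq_trans N0N (leq_addr _ _)); rewrite ler_norml => /andP[h1 h2].
  have := rS (N + j)%N; rewrite -addnS sS => rE.
  by split; lra.
have r0 N : (N0 <= N)%N -> 0 <= r N.
  move=> N0N; have := le_trans (normr_ge0 _) (uM N N0N).
  by rewrite /r -mulrA => h; rewrite mulr_ge0.
have crs N N' : (N0 <= N)%N -> (N0 <= N')%N -> s N - r N <= s N' + r N'.
  move=> hN hN'; have [h1 _] := bnd N N' hN; have [_ h2] := bnd N' N hN'.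
  have := r0 (N + N')%N (leq_trans hN (leq_addr _ _)).
  by rewrite addnC in h2; lra.
pose E : set R := [set x | exists2 N, (N0 <= N)%N & x = s N - r N]%classic.
have Eub N : (N0 <= N)%N -> ubound E (s N + r N).
  by move=> N0N x [N' hN' ->]; exact: crs.
exists (sup E) => N N0N; rewrite -/(s N) -/(r N).
have h1 : s N - r N <= sup E by apply: ub_le_sup; [exists (s N + r N); exact: Eub | exists N].
have h2 : sup E <= s N + r N by apply: ge_sup; [exists (s N - r N), N | exact: Eub].
by rewrite ler_norml; apply/andP; split; lra.
Qed.

(** With v = 1 + y / (d+1) one has v^(d+1) <= e^y and y + B <= c v. Only d of the d + 1 factors v
    are used against (y + B)^d, and the spare one exceeds 2 A c^d once y >= Y. *)
Lemma expR_dominates_power (R : realType) (A B : R) d : 0 < A -> 0 <= B ->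
  exists2 Y, 0 <= Y & forall y, Y <= y -> A * (y + B) ^+ d * expR (- y) <= 1 / 2.
Proof.
move=> A0 B0; set c := B + d.+1%:R.
have c0 : 0 < c by rewrite /c ltr_wpDl.
pose Y := d.+1%:R * (2 * A * c ^+ d).
have cd : 0 < c ^+ d by rewrite exprn_gt0.
have Y0 : 0 <= Y by rewrite /Y !mulr_ge0 // ltW.
exists Y => // y Yy; have y0 : 0 <= y by exact: le_trans Yy.
pose v := 1 + y / d.+1%:R; have v1 : 1 <= v by rewrite /v lerDl divr_ge0.
have v0 : 0 < v by exact: lt_le_trans v1.
have vexp : v ^+ d.+1 <= expR y.
  have -> : y = d.+1%:R * (y / d.+1%:R) by rewrite mulrCA divff ?mulr1 // pnatr_eq0.
  rewrite expRM_natl; apply: lerXn2r; rewrite ?nnegrE ?expR_ge0 ?(ltW v0) //.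
  exact: expR_ge1Dx.
have yB : y + B <= c * v.
  rewrite /c /v; have -> : (B + d.+1%:R) * (1 + y / d.+1%:R) =
     B + y + (d.+1%:R + B * (y / d.+1%:R)).
    have e0 : d.+1%:R != 0 :> R by rewrite pnatr_eq0.
    by move: (d.+1%:R) e0 => e e0; field.
  by rewrite [y + B]addrC lerDl addr_ge0 // mulr_ge0 // divr_ge0.
rewrite expRN ler_pdivrMr ?expR_gt0 //.
apply: le_trans (_ : _ <= A * (c * v) ^+ d) _.
  rewrite ler_wpM2l ?(ltW A0) //; apply: lerXn2r; rewrite ?nnegrE ?addr_ge0 //.
  by rewrite mulr_ge0 // ltW.
have Ycv : 2 * A * c ^+ d <= v.
  have : 2 * A * c ^+ d <= y / d.+1%:R by rewrite ler_pdivlMr ?ltr0n // mulrC.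
  by move=> h; apply: le_trans h _; rewrite /v lerDr.
have := ler_wpM2r (exprn_ge0 d (ltW v0)) Ycv; rewrite -exprS => h3.
have := le_trans h3 vexp; rewrite exprMn; lra.
Qed.

(** Meant for the initial coefficients, of index at most m + 1, which the growth estimate does not
    cover; their denominators are dominated by their leading terms far out. *)
Lemma ratpole_bounded (R : realType) (f : nat -> {fraction {poly R[i]}}) N :
  exists T : R, forall k t, (k < N)%N -> T <= ComplexField.Normc.normc t ->
    ~~ ratpole (f k) t.
Proof.
have Nc := abs_value_normc R.
elim: N => [|N [T IH]]; first by exists 0.
have [rho0 rho1 dom] := dominant_ex Nc (ratden_neq0 (f N)).
exists (Num.max T rho0) => k t; rewrite ltnS leq_eqVlt ge_max => /orP[/eqP ->|kN] /andP[Tt rt].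
  have [_ _ /(_ t rt)] := dom _ (lexx rho0) => lo.
  rewrite /ratpole rootE; apply: contraTneq lo => ->.
  rewrite (absv0 Nc) -ltNge divr_gt0 // mulr_gt0 ?exprn_gt0 //.
    by rewrite (absv_gt0 Nc) // lead_coef_eq0 ratden_neq0.
  exact: (lt_le_trans (lt_le_trans ltr01 rho1) rt).
exact: IH.
Qed.

Local Open Scope classical_set_scope.

(** * Branches of the logarithm in a sector *)

Section LogBranch.
Variable R : realType.
Local Notation C := R[i].

Definition polar (rho theta : R) : C := rho%:C%C * (cos theta +i* sin theta)%C.

Lemma normc_polar rho theta : 0 <= rho ->
  ComplexField.Normc.normc (polar rho theta) = rho.
Proof.
move=> rho0; rewrite /polar ComplexField.Normc.normcM /= expr0n /= addr0.
by rewrite cos2Dsin2 sqrtr1 mulr1 sqrtr_sqr ger0_norm.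
Qed.

Lemma polarE rho theta : polar rho theta = (rho * cos theta +i* (rho * sin theta))%C.
Proof. by rewrite /polar /GRing.mul /= /ComplexField.mulc !mul0r subr0 addr0. Qed.

Lemma cexp_eq_polar (z : C) rho theta : 0 < rho -> cexp z = polar rho theta ->
  complex.Re z = ln rho /\ cos (complex.Im z - theta) = 1.
Proof.
move=> rho0; have -> : cexp z = polar (expR (complex.Re z)) (complex.Im z) by [].
move=> zE; have rhoE : expR (complex.Re z) = rho.
  have := congr1 (@ComplexField.Normc.normc R) zE.
  by rewrite !normc_polar ?expR_ge0 ?ltW.
split; first by rewrite -rhoE expRK.
move: zE; rewrite !polarE rhoE.
have rn : rho != 0 by rewrite gt_eqF.
move=> [/(mulfI rn) c /(mulfI rn) s].
by rewrite cosB c s -!expr2 cos2Dsin2.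
Qed.

(** The solutions of cos = 1 are isolated. Between two of them, x < y, the intermediate value
    theorem would reach the midpoint of x and min(y, x + pi), at a distance in ]0, pi/2] from x,
    where cos is not 1 by injectivity on [0, pi]. *)
Lemma continuous_cos1_constant (h : R -> R) : {within `[0, 1], continuous h} ->
  (forall s, 0 <= s <= 1 -> cos (h s) = 1) -> h 1 = h 0.
Proof.
move=> hc hcos.
have key x y (v : R) : cos x = 1 -> cos y = 1 -> x < y -> v = Num.min y (x + pi) ->
    cos ((x + v) / 2) = 1 -> False.
  move=> cx cy xy vE.
  have pi0 : 0 < pi :> R by exact: pi_gt0.
  have xv : x < v by rewrite vE lt_min xy ltrDl.
  have vx : v <= x + pi by rewrite vE ge_min lexx orbT.
  have sx : sin x = 0.
    have h1 := cos2Dsin2 x; rewrite cx expr1n in h1.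
    by apply/eqP; rewrite -sqrf_eq0; apply/eqP; lra.
  set w := (x + v) / 2 - x.
  have -> : (x + v) / 2 = x + w by rewrite /w; lra.
  rewrite cosD cx sx mul0r subr0 mul1r => cw.
  have w0 : 0 < w by rewrite /w; lra.
  have wpi : w <= pi by rewrite /w; lra.
  have := @cos_inj R w 0; rewrite !in_itv /= lexx (ltW w0) wpi (ltW pi0).
  by move=> /(_ isT isT); rewrite cos0 => /(_ cw) wE; rewrite wE ltxx in w0.
have i0 : 0 <= (0 : R) <= 1 by rewrite lexx ler01.
have i1 : 0 <= (1 : R) <= 1 by rewrite lexx ler01.
have mid x y : cos x = 1 -> cos y = 1 -> x < y ->
    Num.min (h 0) (h 1) <= x -> y <= Num.max (h 0) (h 1) -> False.
  move=> cx cy xy lo hi; set v := Num.min y (x + pi).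
  have pi0 : 0 < pi :> R by exact: pi_gt0.
  have xv : x < v by rewrite lt_min xy ltrDl.
  have vy : v <= y by rewrite ge_min lexx.
  have [|c] := @IVT R h 0 1 ((x + v) / 2) ler01 hc.
    by apply/andP; split; lra.
  rewrite in_itv /= => cI hcE; by apply: (@key x y v) => //; rewrite -hcE; exact: hcos.
have [h10|h01|//] := ltgtP (h 1) (h 0).
- have lo : Num.min (h 0) (h 1) <= h 1 by rewrite ge_min lexx orbT.
  have hi : h 0 <= Num.max (h 0) (h 1) by rewrite le_max lexx.
  by have := mid _ _ (hcos _ i1) (hcos _ i0) h10 lo hi.
- have lo : Num.min (h 0) (h 1) <= h 0 by rewrite ge_min lexx.
  have hi : h 1 <= Num.max (h 0) (h 1) by rewrite le_max lexx orbT.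
  by have := mid _ _ (hcos _ i0) (hcos _ i1) h01 lo hi.
Qed.

Lemma normC_ltP (z : C) (e : R) : (`|z| < e%:C%C) = (ComplexField.Normc.normc z < e).
Proof. by rewrite normc_def ltcR; case: z. Qed.

Lemma normc_le_ReIm (z : C) :
  ComplexField.Normc.normc z <= `|complex.Re z| + `|complex.Im z|.
Proof.
case: z => a b /=; rewrite -[leRHS]ger0_norm ?addr_ge0 // -sqrtr_sqr.
rewrite ler_wsqrtr // sqrrD !real_normK ?num_real //.
by rewrite lerD2r lerDl mulrn_wge0 // mulr_ge0.
Qed.

Lemma Im_le_normc (z : C) : `|complex.Im z| <= ComplexField.Normc.normc z.
Proof.
case: z => a b /=; rewrite -sqrtr_sqr ler_wsqrtr //.
by rewrite lerDr sqr_ge0.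
Qed.

Lemma Re_le_normc (z : C) : `|complex.Re z| <= ComplexField.Normc.normc z.
Proof.
case: z => a b /=; rewrite -sqrtr_sqr ler_wsqrtr //.
by rewrite lerDl sqr_ge0.
Qed.

Lemma continuous_complex (g h : R -> R) s : {for s, continuous g} ->
  {for s, continuous h} -> {for s, continuous (fun s : R => (g s +i* h s)%C : C^o)}.
Proof.
move=> gc hc; apply/cvgrPdist_lt => e e0.
have [e' e'0 eE] : exists2 e' : R, 0 < e' & e = e'%:C%C.
  move: e0; case: e => a b; rewrite ltcE /= => /andP[/eqP -> a0].
  by exists a.
move/cvgrPdist_lt/(_ (e' / 2)): gc => /(_ (divr_gt0 e'0 (ltr0Sn _ 1))) gc.
move/cvgrPdist_lt/(_ (e' / 2)): hc => /(_ (divr_gt0 e'0 (ltr0Sn _ 1))) hc.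
near=> t; rewrite eE normC_ltP.
apply: le_lt_trans (normc_le_ReIm _) _ => /=.
have h1 : `|g s - g t| < e' / 2 by near: t.
have h2 : `|h s - h t| < e' / 2 by near: t.
by lra.
Unshelve. all: by end_near. Qed.

Lemma continuous_Im (f : R -> C^o) s : {for s, continuous f} ->
  {for s, continuous (fun s : R => complex.Im (f s) : R)}.
Proof.
move=> fc; apply/cvgrPdist_lt => e e0.
have e0' : 0 < e%:C%C :> C by rewrite ltcR.
move/cvgrPdist_lt/(_ _ e0'): fc => fc.
near=> t; have : `|f s - f t| < e%:C%C by near: t.
rewrite normC_ltP; apply: le_lt_trans; apply: le_trans (Im_le_normc _).
by case: (f s) (f t) => [a b] [c d].
Unshelve. all: by end_near. Qed.

(** Im L - theta is continuous with values in 2 pi Z, encoded by cos = 1. Along a segment in the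
    coordinates (rho, theta), which stays in the sector, it is constant; so Im L differs from theta
    by one constant fixed at a base point. *)
Lemma log_branch_bounded (alpha beta r1 : R) (L : C -> C) :
  log_branch (sector alpha beta r1) L -> exists2 B, 0 <= B &
  forall rho theta, 0 < rho < r1 -> alpha < theta < beta ->
    complex.Re (L (polar rho theta)) = ln rho /\
    `|complex.Im (L (polar rho theta))| <= B.
Proof.
move=> Llog.
have [[rho0 [theta0 [r0 t0]]]|none] := pselect (exists rho theta : R,
    0 < rho < r1 /\ alpha < theta < beta); last first.
  by exists 0 => // rho theta r t; exfalso; apply: none; exists rho, theta.
pose c := complex.Im (L (polar rho0 theta0)) - theta0.
exists (`|c| + (`|alpha| + `|beta|)); first by rewrite !addr_ge0.
move=> rho theta r t.
have S rho' theta' : 0 < rho' < r1 -> alpha < theta' < beta ->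
    sector alpha beta r1 (polar rho' theta') by move=> ? ?; exists rho', theta'.
have [ReL _] : complex.Re (L (polar rho theta)) = ln rho /\
    cos (complex.Im (L (polar rho theta)) - theta) = 1.
  have /andP[rp _] := r; apply: cexp_eq_polar => //.
  by have [_] := Llog _ (S _ _ r t).
split=> //.
pose rs (s : R) := rho0 + s * (rho - rho0); pose ts (s : R) := theta0 + s * (theta - theta0).
pose h s := complex.Im (L (polar (rs s) (ts s))) - ts s.
have conv (a b x y s : R) : 0 <= s <= 1 -> a < x < b -> a < y < b ->
    a < x + s * (y - x) < b.
  move=> /andP[s0 s1] /andP[ax xb] /andP[ay yb].
  have s1' : 0 <= 1 - s by rewrite subr_ge0.
  have [xy|/ltW yx] := leP x y; [have d0 : 0 <= y - x by rewrite subr_ge0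
    | have d0 : 0 <= x - y by rewrite subr_ge0];
  by have := mulr_ge0 s0 d0; have := mulr_ge0 s1' d0; move=> *; apply/andP; split; lra.
have rsP s : 0 <= s <= 1 -> 0 < rs s < r1 by move=> sI; exact: conv.
have tsP s : 0 <= s <= 1 -> alpha < ts s < beta by move=> sI; exact: conv.
have lin (x y s : R) : {for s, continuous (fun s : R => x + s * y : R)}.
  apply: cvgD; first exact: cvg_cst.
  by apply: cvgM; [exact: cvg_id | exact: cvg_cst].
have h10 : h 1 = h 0.
  apply: continuous_cos1_constant => [|s sI]; last first.
    have /andP[rp _] := rsP s sI; apply: (proj2 (cexp_eq_polar (rho := rs s) rp _)).
    by have [_] := Llog _ (S _ _ (rsP s sI) (tsP s sI)).
  apply: continuous_in_subspaceT => s /set_mem /= sI.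
  have {}sI : 0 <= s <= 1 by move: sI; rewrite in_itv.
  apply: cvgB; last exact: lin.
  have pc : {for s, continuous (fun s : R => polar (rs s) (ts s) : C^o)}.
    have -> : (fun s => polar (rs s) (ts s) : C^o) =
        (fun s => (rs s * cos (ts s) +i* (rs s * sin (ts s)))%C : C^o).
      by apply/funext => x; rewrite polarE.
    apply: continuous_complex; apply: cvgM; try exact: lin.
      apply: (@continuous_comp _ _ _ ts (@cos R)); first exact: lin.
      exact: continuous_cos.
    apply: (@continuous_comp _ _ _ ts (@sin R)); first exact: lin.
    exact: continuous_sin.
  have Lc : {for polar (rs s) (ts s), continuous (L : C^o -> C^o)}.
    apply: differentiable_continuous; apply/derivable1_diffP.
    by have [] := Llog _ (S _ _ (rsP s sI) (tsP s sI)).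
  apply: (@continuous_Im (fun s => L (polar (rs s) (ts s)))).
  move: pc Lc; set g := fun s : R => _ : C^o; move: (L : C^o -> C^o) => L' gc Lc.
  exact: (@continuous_comp R C^o C^o g L' s gc Lc).
have -> : complex.Im (L (polar rho theta)) = c + theta.
  move: h10; rewrite /h /rs /ts !mul1r !mul0r !addr0 ![_ + (_ - _)]addrC !subrK.
  by rewrite -/c => <-; rewrite subrK.
apply: le_trans (ler_normD _ _) _; rewrite lerD2l.
have /andP[at_ tb] := t; rewrite ler_norml.
have := ler_norm beta; have := ler_norm (- alpha); rewrite normrN.
have := normr_ge0 alpha; have := normr_ge0 beta.
by move=> *; apply/andP; split; lra.
Qed.

End LogBranch.

Lemma uniform_cvg_geometric (R : realType) (S : set R[i]) (u : nat -> R[i] -> R[i])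
    (f : R[i] -> R[i]) (M : R) N0 :
  (forall x N, S x -> (N0 <= N)%N ->
     ComplexField.Normc.normc (u N x - f x) <= M / 2 ^+ N) ->
  {uniform S, (u : nat -> R[i] -> R[i]^o) @ \oo --> (f : R[i] -> R[i]^o)}.
Proof.
move=> uM P /uniform_nbhs [E [+ subP]]; rewrite -entourage_ballE => -[e /= e0 subE].
have [e' e'0 eE] : exists2 e' : R, 0 < e' & e = e'%:C%C.
  move: e0; case: e {subE} => a b; rewrite ltcE /= => /andP[/eqP -> a0].
  by exists a.
exists (maxn N0 (Num.bound (`|M| / e'))) => // N /=; rewrite geq_max => /andP[N0N bN].
apply: subP => x Sx /=; apply: subE => /=.
rewrite -ball_normE /= eE normC_ltP -normcN opprB.
apply: le_lt_trans (uM x N Sx N0N) _.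
rewrite ltr_pdivrMr ?exprn_gt0 //; apply: le_lt_trans (ler_norm M) _.
rewrite mulrC -ltr_pdivrMr //.
have Me : 0 <= `|M| / e' by rewrite divr_ge0 // ltW.
apply: lt_le_trans (archi_boundP Me) _.
apply: le_trans (_ : _ <= N%:R) _; first by rewrite ler_nat.
by rewrite -natrX ler_nat ltnW // ltn_expl.
Qed.

Lemma Re_sum (R : realType) (u : nat -> R[i]) N :
  complex.Re (\sum_(k < N) u k) = \sum_(k < N) complex.Re (u k).
Proof.
elim: N => [|N IH]; first by rewrite !big_ord0.
by rewrite !big_ord_recr /= -IH; case: (\sum_(k < N) u k) (u N) => [a b] [c d].
Qed.

Lemma Im_sum (R : realType) (u : nat -> R[i]) N :
  complex.Im (\sum_(k < N) u k) = \sum_(k < N) complex.Im (u k).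
Proof.
elim: N => [|N IH]; first by rewrite !big_ord0.
by rewrite !big_ord_recr /= -IH; case: (\sum_(k < N) u k) (u N) => [a b] [c d].
Qed.

Lemma complex_geometric_limit (R : realType) (u : nat -> R[i]) (M : R) N0 :
  (forall k, (N0 <= k)%N -> ComplexField.Normc.normc (u k) <= M / 2 ^+ k) ->
  exists l, forall N, (N0 <= N)%N ->
    ComplexField.Normc.normc (\sum_(k < N) u k - l) <= 4 * M / 2 ^+ N.
Proof.
move=> uM.
have [a aP] := @geometric_limit R (fun k => complex.Re (u k)) M N0
  (fun k h => le_trans (Re_le_normc _) (uM k h)).
have [b bP] := @geometric_limit R (fun k => complex.Im (u k)) M N0
  (fun k h => le_trans (Im_le_normc _) (uM k h)).
exists (a +i* b)%C => N N0N; apply: le_trans (normc_le_ReIm _) _.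
have -> : complex.Re (\sum_(k < N) u k - (a +i* b)%C) = \sum_(k < N) complex.Re (u k) - a.
  by rewrite -Re_sum; case: (\sum_(k < N) u k).
have -> : complex.Im (\sum_(k < N) u k - (a +i* b)%C) = \sum_(k < N) complex.Im (u k) - b.
  by rewrite -Im_sum; case: (\sum_(k < N) u k).
have := aP N N0N; have := bP N N0N.
have -> : 4 * M / 2 ^+ N = 2 * M / 2 ^+ N + 2 * M / 2 ^+ N by ring.
lra.
Qed.

Theorem theorem1 (R : realType) (n : nat) (F : mpoly.mpoly n.+2 R[i])
    (phi : powlog R) (m : nat)
    (F_phi : pl_subst F phi = 0)
    (dF_ge_m : forall (j : 'I_n.+1) (k : nat), (k < m)%N ->
       fcoef (pl_subst (dFdy j F) phi) k = 0)
    (dF_n_m : fcoef (pl_subst (dFdy ord_max F) phi) m != 0)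
    (alpha beta r1 : R) (L : R[i] -> R[i])
    (lt_alpha_beta : alpha < beta)
    (opening_lt_2pi : beta - alpha < 2 * pi)
    (r1_gt0 : 0 < r1)
    (L_log : log_branch (sector alpha beta r1) L) :
  exists2 r0 : R, 0 < r0 &
    forall r : R, 0 < r -> r <= r0 -> r <= r1 ->
      pl_cvg_uniformly (sector alpha beta r) L phi.
Proof.
have [d [T [A [T1 A0 growth]]]] := powlog_growth F_phi dF_ge_m dF_n_m.
have [B B0 Lbound] := log_branch_bounded L_log.
have [T' nopole] := ratpole_bounded (fcoef phi) m.+2.
have [Y Y0 small] := expR_dominates_power d A0 B0.
(* With y = - ln |x|, the condition |x| < e^(-Y') forces y >= Y', and |L x| >= y. Then [T] gives the
   growth bound, [T'] excludes poles of the first coefficients, and [Y] makes the ratio at most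
   1/2. *)
pose Y' := Num.max Y (Num.max T T').
exists (expR (- Y')); first exact: expR_gt0.
move=> r r_gt0 rr0 rr1.
have inS x : sector alpha beta r x -> exists y : R,
    [/\ Y' <= y, y <= ComplexField.Normc.normc (L x),
      ComplexField.Normc.normc (L x) <= y + B &
      ComplexField.Normc.normc x = expR (- y)].
  move=> [rho [theta [/andP[rho0 rhor] th ->]]]; rewrite -/(polar rho theta).
  have [|ReL ImL] := Lbound rho theta _ th.
    by rewrite rho0 (lt_le_trans rhor rr1).
  have Yln : Y' <= - ln rho.
    rewrite lerNr -[leRHS]expRK; rewrite ler_ln ?posrE ?expR_gt0 //.
    by rewrite ltW // (lt_le_trans rhor).
  exists (- ln rho); split=> //.
  - rewrite -ReL; apply: le_trans (Re_le_normc _).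
    by rewrite -normrN ler_norm.
  - apply: le_trans (normc_le_ReIm _) _; apply: lerD => //.
    rewrite ReL -normrN ger0_norm //; apply: le_trans Yln.
    by rewrite /Y' le_max Y0.
  - by rewrite opprK lnK ?posrE // normc_polar // ltW.
have big x : sector alpha beta r x -> T <= ComplexField.Normc.normc (L x) /\
    T' <= ComplexField.Normc.normc (L x).
  move=> /inS[y [Yy yL _ _]]; have := le_trans Yy yL.
  by rewrite /Y' !ge_max => /andP[_ /andP[]].
have idx k : (m.+2 <= k)%N -> k = (m.+1 + (k - m.+2).+1)%N.
  by move=> mk; rewrite addnS -addSn subnKC.
pose u k x := rateval (fcoef phi k) (L x) * x ^+ k.
(* For k = (m+1) + (j+1), the factor x^(m+1) has modulus at most 1 and the rest is at most (A
   (y+B)^d e^(-y))^(j+1) <= 2^-(j+1), which is 2^(m+1) / 2^k. *)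
have ubound x k : sector alpha beta r x -> (m.+2 <= k)%N ->
    ComplexField.Normc.normc (u k x) <= 2 ^+ m.+1 / 2 ^+ k.
  move=> Sx mk; have [y [Yy yL Ly xy]] := inS x Sx; have [TL _] := big x Sx.
  rewrite (idx _ mk).
  move: (k - m.+2)%N => j; have [_ val] := growth j (L x) TL.
  have Nc := abs_value_normc R.
  rewrite /u (absvM Nc) (absvX Nc) xy [in leRHS]exprD invfM mulrA divff ?expf_neq0 // mul1r.
  have ey0 : 0 <= expR (- y) by exact: expR_ge0.
  have ey1 : expR (- y) <= 1.
    rewrite -expR0 ler_expR oppr_le0; apply: le_trans Yy.
    by rewrite /Y' le_max Y0.
  apply: le_trans (_ : _ <= (A * (y + B) ^+ d) ^+ j.+1 * expR (- y) ^+ j.+1) _.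
    apply: ler_pM; rewrite ?exprn_ge0 ?(absv_ge0 Nc) //.
      apply: le_trans val _; apply: lerXn2r.
      - by rewrite nnegrE mulr_ge0 ?(ltW A0) // exprn_ge0 ?(absv_ge0 Nc).
      - rewrite nnegrE mulr_ge0 ?(ltW A0) // exprn_ge0 //.
        exact: le_trans (absv_ge0 Nc _) Ly.
      rewrite ler_wpM2l ?(ltW A0) //; apply: lerXn2r => //.
        by rewrite nnegrE (absv_ge0 Nc).
      by rewrite nnegrE; exact: le_trans (absv_ge0 Nc _) Ly.
    rewrite exprD ler_piMl ?exprn_ge0 //; exact: exprn_ile1.
  rewrite -exprMn -exprVn -div1r; apply: lerXn2r.
  - rewrite nnegrE mulr_ge0 // mulr_ge0 ?(ltW A0) // exprn_ge0 //.
    exact: le_trans (absv_ge0 Nc _) Ly.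
  - by rewrite nnegrE.
  by apply: small; apply: le_trans Yy; rewrite /Y' le_max lexx.
split.
  move=> k x Sx; have [TL T'L] := big x Sx.
  have [km|mk] := ltnP k m.+2; first exact: nopole.
  rewrite (idx _ mk).
  by have [] := growth (k - m.+2)%N (L x) TL.
have /choice[f fP] : forall x, exists fx, sector alpha beta r x ->
    forall N, (m.+2 <= N)%N ->
    ComplexField.Normc.normc (\sum_(k < N) u k x - fx) <= 4 * 2 ^+ m.+1 / 2 ^+ N.
  move=> x; have [Sx|nSx] := pselect (sector alpha beta r x); last by exists 0.
  have [l lP] := @complex_geometric_limit R (fun k => u k x) (2 ^+ m.+1) m.+2
    (fun k h => ubound x k Sx h).
  by exists l.
exists f; apply: (@uniform_cvg_geometric _ _ _ _ (4 * 2 ^+ m.+1) m.+2) => x N Sx h.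
exact: fP.
Qed.
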